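(* For all integers $n\ge m+1\ge 4$, $R(\mathcal{C}^4_n,\mathcal{C}^4_m)=3n+\lfloor\frac{m-1}{2}\rfloor$.
   Context: $\mathcal{C}^4_n$ is the $4$-uniform loose cycle: vertex set $\{v_1,\dots,v_{3n}\}$ and edges $\{v_{3i-2},v_{3i-1},v_{3i},v_{3i+1}\}$, $1\le i\le n$, indices modulo $3n$. For $4$-uniform hypergraphs $\mathcal{G},\mathcal{H}$, the Ramsey number $R(\mathcal{G},\mathcal{H})$ is the least $N$ such that every red/blue coloring of the edges of the complete $4$-uniform hypergraph $\mathcal{K}^4_N$ contains a red copy of $\mathcal{G}$ or a blue copy of $\mathcal{H}$. *)

(* Defs.v *)
From mathcomp Require Import all_boot.
Set Implicit Arguments. Unset Strict Implicit. Unset Printing Implicit Defensive.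

(* Vertices of the 4-uniform loose cycle C^4_n are 'I_(3n) (0-based: v_{k+1} ~ k).
   Edge i (0 <= i < n) is {3i, 3i+1, 3i+2, 3i+3 mod 3n}. *)
Definition loose_edge (n : nat) (i : nat) : {set 'I_(3 * n)} :=
  [set x : 'I_(3 * n) | [exists k : 'I_4, val x == (3 * i + k) %% (3 * n)]].

(* A red/blue colouring of K^4_N: a function on subsets of 'I_N; only its values
   on 4-element subsets matter. [true] = red, [false] = blue. *)
Definition coloring (N : nat) := {set 'I_N} -> bool.

Definition has_mono_cycle (N : nat) (c : coloring N) (b : bool) (n : nat) : Prop :=
  exists f : 'I_(3 * n) -> 'I_N, injective f /\
    forall i, i < n -> c (f @: loose_edge n i) = b.

Definition ramsey_prop (n m N : nat) : Prop :=
  forall c : coloring N, has_mono_cycle c true n \/ has_mono_cycle c false m.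

Definition ramsey_cycle_is (n m N : nat) : Prop :=
  ramsey_prop n m N /\ forall N', N' < N -> ~ ramsey_prop n m N'.

(* Main.v *)
Require Import Defs.
From mathcomp Require Import all_boot zify.
Set Implicit Arguments. Unset Strict Implicit. Unset Printing Implicit Defensive.
(**
Lower bound: colour red exactly the edges inside a set of [3n - 1] vertices; every
edge of a blue cycle meets the [(m - 1) / 2] remaining vertices, each of which lies on
at most two edges of the cycle.

Upper bound: let [C] be a red cycle with [r >= m] edges, [W] the vertices outside [C],
and suppose that there is no red cycle with [r + 1] edges.  Cut [C] into segments of one
or two edges.  A segment with interior [s] leaves [C] at [g]; it may be entered at any
vertex [u] of the last three of the preceding segment, because an edge is a set and its
hinge can be moved inside it.  No red path from [u] to [g] through [s ++ W] is one edge
longer than the segment, and this forces blue paths of the length of the segment between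
nearly all pairs of [W], through a pool that misses [u], or [g], or another of the last
three vertices of the segment; the missed vertex serves as the next entry, so that the
pools of consecutive segments are disjoint.  For a fixed pool the pairs that are not
joined are covered by at most two vertices of [W].  If for every segment the pool that
misses [u] leaves only a star of unjoined pairs, a greedy choice of hinges in [W] closes
the blue cycle.  Otherwise take an exceptional segment last: using two spare vertices of
[W], it joins every pair.

To start the induction at [n = m + 1], a monochromatic cycle with [m] edges is obtained
from one with [m - 1] edges in the same way, except that one segment of a single edge is
traversed by two blue edges, with three vertices of [W] set aside for it.
*)

(** * Tactics for arithmetic, distinctness and reordering of explicit lists *)

Ltac arith :=
  repeat match goal with
  | H : ?T |- _ =>
    match type of T with Prop =>
      lazymatch T with
      | @eq ?A _ _ => tryif unify A nat then fail else clear H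
      | is_true (leq _ _) => fail
      | is_true (leq _ _ && leq _ _) => fail
      | is_true (dvdn _ _) => fail
      | is_true (odd _) => fail
      | is_true (~~ odd _) => fail
      | _ => clear H
      end
    end
  end; lia.

Ltac split_uniq H :=
  rewrite /= ?inE ?negb_or -?andbA in H;
  repeat match goal with K : is_true (_ && _) |- _ => case/andP: K => ? ? end.
Ltac distinct :=
  rewrite /= ?inE ?negb_or; repeat (apply/andP; split); first [done | by rewrite eq_sym].

Ltac use_neqs :=
  repeat match goal with
  | K : is_true (?a != ?b) |- context [?a == ?b] => rewrite (negbTE K)
  | K : is_true (?a != ?b) |- context [?b == ?a] => rewrite [b == a]eq_sym (negbTE K)
  end.

Ltac reorder :=
  apply/permP => ? /=;
  repeat match goal with |- context [nat_of_bool (?Q ?b)] => case: (Q b) end; done.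

(** * Loose paths and cycles *)

Lemma seq3_ind (T : Type) (P : seq T -> Prop) :
  P [::] -> (forall a b d s, 3 %| size s -> P s -> P [:: a, b, d & s]) ->
  forall s, 3 %| size s -> P s.
Proof.
move=> P0 PS s; have [n] := ubnP (size s); elim: n s => // n IHn.
case=> [|a [|b [|d s]]] //= size_s; rewrite -(addn3 (size s)) dvdn_addl // => dvd_s.
by apply: PS => //; apply: IHn => //; lia.
Qed.

Section LoosePaths.
Variables (V : finType) (c : {set V} -> bool).
Implicit Types (x y u : V) (p q P : seq V) (b : bool) (k : nat).

(* [x :: p] lists the vertices of a loose path with hinges at the positions
   divisible by 3; a cycle is a path that starts at its own last vertex. *)
Fixpoint lpath b x p : bool :=
  if p is [:: v1, v2, v3 & p'] then
    (c [set z in [:: x; v1; v2; v3]] == b) && lpath b v3 p'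
  else true.

Definition lcycle b p : bool := if p is x :: _ then lpath b (last x p) p else true.

Definition has_lcycle b n : bool :=
  [exists p : (3 * n).-tuple V, uniq p && lcycle b p].

Lemma has_lcycleP b n :
  reflect (exists p, [/\ size p = 3 * n, uniq p & lcycle b p]) (has_lcycle b n).
Proof.
apply: (iffP existsP) => [[p /andP[up cp]]|[p [sp up cp]]].
  by exists p; rewrite size_tuple.
have sp' : size p == 3 * n by rewrite sp.
by exists (Tuple sp'); rewrite up.
Qed.

Lemma eq_set_seq (s t : seq V) : s =i t -> [set z in s] = [set z in t].
Proof. by move=> eq_st; apply/setP=> z; rewrite !inE eq_st. Qed.

Lemma lpath_cat b x p q :
  3 %| size p -> lpath b x (p ++ q) = lpath b x p && lpath b (last x p) q.
Proof.
move=> dvd_p; move: p dvd_p x; apply: seq3_ind => //= v1 v2 v3 p _ IHp x.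
by rewrite IHp andbA.
Qed.

(** An edge is a set, and with length divisible by 3 the hinges of the reversed list are again at
    multiples of 3, so both lists have the same edges. *)
Lemma lpath_rev b x p :
  3 %| size p -> lpath b (last x p) (rev (belast x p)) = lpath b x p.
Proof.
move=> dvd_p; move: p dvd_p x; apply: seq3_ind => //= v1 v2 v3 p dvd_p IHp x.
have -> : rev [:: x, v1, v2 & belast v3 p] = rev (belast v3 p) ++ [:: v2; v1; x].
  by rewrite !rev_cons -!cats1 -!catA.
rewrite lpath_cat ?size_rev ?size_belast // IHp /= andbT andbC; congr (_ && _).
have -> : last (last v3 p) (rev (belast v3 p)) = v3.
  by case: (p) => //= a p'; rewrite rev_cons last_rcons.
congr (c _ == b); apply: eq_set_seq => z.
by rewrite !inE; do 4!case: (z == _).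
Qed.

Lemma lcycleE b x p : lcycle b p = lpath b (last x p) p.
Proof. by case: p. Qed.

Lemma lcycle_rot b p q :
  3 %| size p -> 3 %| size q -> lcycle b (p ++ q) = lcycle b (q ++ p).
Proof.
case: p => [|x p]; first by rewrite cats0.
case: q => [|y q]; first by rewrite cats0.
move=> dvd_p dvd_q; rewrite !(lcycleE _ x) !lpath_cat // !last_cat /=.
by rewrite andbC.
Qed.

(** The last vertex of a cycle is a hinge. It stays in place while the others are reversed, which
    keeps the hinges at the right positions. *)
Lemma lcycle_rev b y q :
  3 %| size (rcons q y) -> lcycle b (rcons (rev q) y) = lcycle b (rcons q y).
Proof.
move=> dvd_q; rewrite !(lcycleE _ y) !last_rcons.
by rewrite -(lpath_rev b y dvd_q) last_rcons belast_rcons rev_cons.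
Qed.

(** A path with [k] edges has [3k - 1] vertices between its ends. Only the interior is constrained
    by the pool; that the ends lie off it follows from the disjointness of pools and hinges when
    paths are assembled. *)
Definition joined b k P x y : bool :=
  [exists q : (3 * k).-1.-tuple V, [&& uniq q, all (mem P) q & lpath b x (rcons q y)]].

Lemma joinedP b k P x y :
  reflect (exists q, [/\ size q = (3 * k).-1, uniq q, {subset q <= P}
                       & lpath b x (rcons q y)]) (joined b k P x y).
Proof.
apply: (iffP existsP) => [[q /and3P[uq /allP sqP pq]]|[q [sq uq sqP pq]]].
  by exists q; rewrite size_tuple.
have sq' : size q == (3 * k).-1 by rewrite sq.
by exists (Tuple sq'); rewrite /= uq pq andbT; apply/allP.
Qed.

Lemma joined_sub b k P Q x y : {subset P <= Q} -> joined b k P x y -> joined b k Q x y.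
Proof.
move=> sPQ /joinedP[q [sq uq sqP pq]]; apply/joinedP; exists q; split=> //.
by move=> z /sqP/sPQ.
Qed.

Lemma joined_sym b k P x y : 0 < k -> joined b k P x y = joined b k P y x.
Proof.
move=> k_gt0; suff imp x' y' : joined b k P x' y' -> joined b k P y' x'.
  by apply/idP/idP; apply: imp.
move=> /joinedP[q [sq uq sqP pq]]; apply/joinedP; exists (rev q).
rewrite size_rev rev_uniq; split=> // [z|]; first by rewrite mem_rev => /sqP.
have dvd_q : 3 %| size (rcons q y').
  by rewrite size_rcons sq prednK ?dvdn_mulr // muln_gt0.
by rewrite -rev_cons -(belast_rcons x' q y') -(lpath_rev b x' dvd_q) last_rcons in pq *.
Qed.

End LoosePaths.

(** * A verified case-splitting procedure for colourings of small configurations *)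

Notation edge_lit := (seq nat * bool)%type.

(* A literal [(e, b)] says that the edge on the indices [e] has colour [b]. *)
Section Refutation.

Definition lit_sat (v : seq nat -> bool) (cl : seq edge_lit) :=
  has (fun l => v l.1 == l.2) cl.

Definition assign (l : edge_lit) (F : seq (seq edge_lit)) :=
  [seq [seq l' <- cl | l' != (l.1, ~~ l.2)] | cl <- F & l \notin cl].

Definition shortest (F : seq (seq edge_lit)) :=
  foldr (fun cl s => if size cl <= size s then cl else s) (head [::] F) F.

(** Branching on a shortest clause amounts to unit propagation whenever a unit clause exists.
    [shortest] is empty also when [F] has no clause, hence the explicit test that the empty clause
    belongs to [F]. The first argument bounds the depth. *)
Fixpoint refute (n : nat) (F : seq (seq edge_lit)) : bool :=
  if n is n'.+1 then
    if shortest F is l :: _ then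
      refute n' (assign l F) && refute n' (assign (l.1, ~~ l.2) F)
    else [::] \in F
  else false.

Lemma lit_sat_assign v l F :
  v l.1 == l.2 -> all (lit_sat v) F -> all (lit_sat v) (assign l F).
Proof.
move=> /eqP vl /allP satF; apply/allP=> _ /mapP[cl clF ->].
move: clF; rewrite mem_filter => /andP[_ /satF /hasP[l' l'cl vl']].
apply/hasP; exists l' => //; rewrite mem_filter l'cl andbT.
apply: contraTneq vl' => -> /=; rewrite vl; by case: (l.2).
Qed.

Lemma refute_sound n F v : refute n F -> ~~ all (lit_sat v) F.
Proof.
elim: n F => // n IHn F /=; case: (shortest F) => [F0|l _ /andP[Fl Fnl]].
  by apply/negP => /allP/(_ _ F0).
apply/negP=> satF; case: (boolP (v l.1 == l.2)) => vl.
  by have /negP := IHn _ Fl; apply; apply: lit_sat_assign.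
have /negP := IHn _ Fnl; apply; apply: lit_sat_assign => //=.
by move: vl; case: (v l.1); case: (l.2).
Qed.

End Refutation.

Section Certificates.
Variables (V : finType) (c : {set V} -> bool).

Fixpoint path_edges (x : nat) (p : seq nat) : seq (seq nat) :=
  if p is [:: v1, v2, v3 & p'] then
    sort leq [:: x; v1; v2; v3] :: path_edges v3 p'
  else [::].

(* The constraint [(b, k, s, t, pool)] forbids the paths with [k] edges, all of
   colour [b], from [s] to [t] through [pool]; each listed interior [q] is an
   instance of it, and the clauses of these instances must be refutable. *)
Notation constraint := (bool * nat * nat * nat * seq nat)%type.

(** A forbidden path has at least one edge of the opposite colour. *)
Definition instance_clause (h : constraint) (q : seq nat) : seq edge_lit :=
  let: (b, k, s, t, pool) := h in [seq (e, ~~ b) | e <- path_edges s (rcons q t)].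

Definition instance_ok (n : nat) (h : constraint) (q : seq nat) : bool :=
  let: (b, k, s, t, pool) := h in
  [&& 0 < k, size q == (3 * k).-1, uniq q, all (mem pool) q & all (ltn^~ n) q].

(** Index lists are sorted so that an edge gives the same literal in whatever order a path visits
    its vertices. *)
Definition refutes (n : nat) (units : seq edge_lit)
    (cert : seq (constraint * seq (seq nat))) : bool :=
  all (fun hq => all (instance_ok n hq.1) hq.2) cert &&
  refute 200 ([seq [:: (sort leq l.1, l.2)] | l <- units] ++
              flatten [seq map (instance_clause hq.1) hq.2 | hq <- cert]).

Lemma lpath_edges (f : nat -> V) b x p :
  lpath c b (f x) (map f p) =
  all (fun e => c [set z in map f e] == b) (path_edges x p).
Proof.
elim: {p}(size p) {-2}p (leqnn (size p)) x => [|n IHn] p; first by case: p.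
case: p => [|v1 [|v2 [|v3 p]]] //= p_n x; rewrite IHn; last by lia.
congr ((c _ == b) && _); apply: (@eq_set_seq _ (map f [:: x; v1; v2; v3])).
by apply: eq_mem_map => i; rewrite mem_sort.
Qed.

(** The actual colours define a valuation. It satisfies the units by assumption, and every instance
    clause because otherwise the listed interior would realise a forbidden path; a refutable set of
    clauses has no such valuation. *)
Lemma refutation (x0 : V) (vs : seq V) (units : seq edge_lit)
    (cert : seq (constraint * seq (seq nat))) :
  refutes (size vs) units cert -> uniq vs ->
  all (fun l => c [set z in map (nth x0 vs) l.1] == l.2) units ->
  all (fun hq => let: (b, k, s, t, pool) := hq.1 in
         ~~ joined c b k (map (nth x0 vs) pool) (nth x0 vs s) (nth x0 vs t)) cert ->
  False.
Proof.
set f := nth x0 vs => /andP[/allP ok_cert refF] uvs units_ok /allP cert_holds.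
have /negP := refute_sound (fun e => c [set z in map f e]) refF; apply.
rewrite all_cat; apply/andP; split.
  apply/allP=> _ /mapP[l l_u ->]; rewrite /lit_sat /= orbF.
  have <- : [set z in map f l.1] = [set z in map f (sort leq l.1)].
    by apply: eq_set_seq; apply: eq_mem_map => i; rewrite mem_sort.
  exact: (allP units_ok).
apply/allP=> cl /flattenP[_ /mapP[hq hq_c ->] /mapP[q q_qs ->]].
move: (allP (ok_cert _ hq_c) _ q_qs) (cert_holds _ hq_c).
case: (hq.1) => [[[[b k] s] t] pool] /and5P[k_gt0 /eqP sq uq /allP qP /allP qn].
apply: contraR => unsat; apply/joinedP; exists (map f q).
rewrite size_map; split=> //.
- rewrite map_inj_in_uniq // => i j /qn i_n /qn j_n /eqP.
  by rewrite nth_uniq // => /eqP.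
- by move=> _ /mapP[i /qP i_p ->]; apply: map_f.
rewrite -map_rcons lpath_edges; apply/allP=> e e_q; apply: contraR unsat => ce.
apply/hasP; exists (e, ~~ b); first exact: map_f.
by move: ce; case: (c _); case: (b).
Qed.

End Certificates.

(** * Blue paths through a segment *)

Section Tight.
Variables (V : finType) (c : {set V} -> bool).
Implicit Types (u g x y z w : V) (W : seq V) (k : nat).

(** The consequence of maximality for one segment of the red cycle: entry [u], interior [s], exit
    [g], outside vertices [W]. Here [k] is one more than the number of edges of the segment. *)
Definition tight k u (s : seq V) g W : bool :=
  uniq (u :: s ++ g :: W) && ~~ joined c true k (s ++ W) u g.

Lemma tight_uniq k u (s : seq V) g W ws :
  tight k u s g W -> uniq ws -> {subset ws <= W} -> uniq (u :: s ++ g :: ws).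
Proof.
move=> /andP[]; rewrite -cat_rcons -cat_cons cat_uniq => /and3P[u1 /hasPn dis _] _ u2 sW.
rewrite -cat_rcons -cat_cons cat_uniq u1 u2 andbT; apply/hasPn => z /sW; exact: dis.
Qed.

Lemma tight_red k u (s : seq V) g W ws :
  tight k u s g W -> {subset ws <= W} -> ~~ joined c true k (s ++ ws) u g.
Proof.
move=> /andP[_ nj] sub_W; apply: contra nj; apply: joined_sub => z.
by rewrite !mem_cat => /orP[->//|/sub_W->]; rewrite orbT.
Qed.

(** The interior serves only as a pool, so its order can be changed; this lets one certificate cover
    all symmetric configurations. *)
Lemma tight_perm k u (s s' : seq V) g W :
  perm_eq s s' -> tight k u s g W -> tight k u s' g W.
Proof.
move=> ss' /andP[us nj]; rewrite /tight -(perm_uniq (s1 := u :: s ++ g :: W)).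
  rewrite us; apply: contra nj; apply: joined_sub => z.
  by rewrite !mem_cat (perm_mem ss').
by rewrite perm_cons perm_cat2r.
Qed.

(** * Configurations around a segment of two edges *)

(* The certificates are small unsatisfiable cores found by a SAT solver; the numbers
   in them are positions in the list of vertices that is passed to [refutation]. *)
Section Block.
Variables (u b1 b2 b3 b4 b5 g : V) (W : seq V).
Hypothesis tight_b : tight 3 u [:: b1; b2; b3; b4; b5] g W.

(** If this edge were red it would be the first edge of a red path, and then no red path with two
    edges could lead from [b1] to [g]; the blue edges this forces join [x] and [y]. *)
Lemma entry_blue x y z w :
  uniq [:: x; y; z; w] -> {subset [:: x; y; z; w] <= W} ->
  ~~ joined c false 2 [:: b1; b2; b3; b4; b5; g] x y ->
  c [set v in [:: u; b1; z; w]] = false.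
Proof.
move=> ws_uniq ws_W Nxy; apply/negbTE/negP => ubzw.
apply: (@refutation _ c u [:: u; b1; b2; b3; b4; b5; g; x; y; z; w]
  [:: ([:: 0;1;9;10], true)] [::
    (true, 3, 0, 6, [:: 1;2;3;4;5;7;8;9;10],
     [::
      [:: 9;10;1;2;5;8;3;4]; [:: 9;10;1;2;3;7;4;5]; [:: 9;10;1;5;8;4;2;7];
      [:: 9;10;1;4;7;2;3;8]]);
    (false, 2, 7, 8, [:: 1;2;3;4;5;6],
     [::
      [:: 4;6;5;1;2]; [:: 1;2;3;4;6]; [:: 4;6;2;1;5]; [:: 2;3;1;4;5];
      [:: 4;5;6;2;3]; [:: 1;2;4;3;6]])]).
- by vm_compute.
- exact: (tight_uniq tight_b ws_uniq ws_W).
- by rewrite /= ubzw.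
by rewrite /= Nxy (tight_red tight_b ws_W).
Qed.

(** This and the next four lemmas serve the segment that closes the blue cycle: its pool misses [g]
    but gains the spare vertices [s] and [t]. They differ in the pairs that the pool missing [u]
    leaves unjoined, and in the edges at [u] already known to be blue. *)
Lemma spares_join_triangle x y s t :
  uniq [:: x; y; s; t] -> {subset [:: x; y; s; t] <= W} ->
  c [set v in [:: u; b3; y; t]] = false ->
  c [set v in [:: u; b5; y; s]] = false ->
  ~~ joined c false 2 [:: b1; b2; b3; b4; b5; g] s t ->
  ~~ joined c false 2 [:: b1; b2; b3; b4; b5; g] x s ->
  ~~ joined c false 2 [:: b1; b2; b3; b4; b5; g] x t ->
  joined c false 2 [:: u; b1; b2; b3; b4; b5; s; t] x y.
Proof.
move=> ws_uniq ws_W bl1 bl2 Nst Nxs Nxt; apply: contraT => nj; exfalso.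
apply: (@refutation _ c u [:: u; b1; b2; b3; b4; b5; g; x; y; s; t]
  [:: ([:: 0;3;8;10], false); ([:: 0;5;8;9], false)] [::
    (true, 3, 0, 6, [:: 1;2;3;4;5;7;8;9;10],
     [::
      [:: 3;10;7;1;5;2;4;9]; [:: 4;9;7;2;5;10;1;3]]);
    (false, 2, 7, 8, [:: 0;1;2;3;4;5;9;10],
     [::
      [:: 2;5;10;0;3]; [:: 3;10;0;5;9]; [:: 4;9;0;3;10]]);
    (false, 2, 9, 10, [:: 1;2;3;4;5;6],
     [::
      [:: 2;4;6;1;3]]);
    (false, 2, 7, 10, [:: 1;2;3;4;5;6],
     [::
      [:: 2;5;1;3;6]])]).
- by vm_compute.
- exact: (tight_uniq tight_b ws_uniq ws_W).
- by rewrite /= bl1 bl2.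
by rewrite /= nj Nst Nxt (tight_red tight_b ws_W).
Qed.

Lemma spares_join_pairs x y s t :
  uniq [:: x; y; s; t] -> {subset [:: x; y; s; t] <= W} ->
  ~~ joined c false 2 [:: b1; b2; b3; b4; b5; g] s t ->
  ~~ joined c false 2 [:: b1; b2; b3; b4; b5; g] x y ->
  joined c false 2 [:: u; b1; b2; b3; b4; b5; s; t] x y.
Proof.
move=> ws_uniq ws_W Nst Nxy; apply: contraT => nj; exfalso.
apply: (@refutation _ c u [:: u; b1; b2; b3; b4; b5; g; x; y; s; t]
  [::] [::
    (true, 3, 0, 6, [:: 1;2;3;4;5;7;8;9;10],
     [::
      [:: 2;10;8;3;4;1;5;9]; [:: 7;9;2;3;10;8;4;5]; [:: 4;8;2;1;7;5;3;10];
      [:: 2;9;7;1;5;4;3;10]; [:: 5;9;7;3;10;1;2;8]; [:: 4;8;1;5;9;3;2;7];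
      [:: 4;8;5;3;7;1;2;9]; [:: 1;7;3;2;9;5;4;8]; [:: 1;2;8;5;9;10;3;4];
      [:: 7;10;5;2;3;9;1;4]; [:: 3;8;10;4;7;5;1;9]; [:: 3;10;8;2;5;9;1;4];
      [:: 1;7;9;2;3;5;4;8]; [:: 4;8;2;3;9;1;5;10]; [:: 1;9;7;2;3;5;4;10];
      [:: 1;7;5;4;8;2;3;9]; [:: 2;9;7;1;5;3;4;8]; [:: 2;4;8;1;9;10;3;5];
      [:: 3;8;4;5;7;2;1;9]; [:: 5;10;7;1;4;9;2;3]; [:: 4;10;7;2;3;1;5;9];
      [:: 7;9;4;3;8;2;1;10]; [:: 5;10;7;1;9;4;2;8]]);
    (false, 2, 7, 8, [:: 0;1;2;3;4;5;9;10],
     [::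
      [:: 3;10;1;0;2]; [:: 0;5;10;2;3]; [:: 0;4;9;1;10]; [:: 3;10;1;0;4];
      [:: 1;3;2;4;5]; [:: 5;9;0;1;2]; [:: 2;5;3;1;4]; [:: 0;3;1;9;10];
      [:: 5;10;4;0;3]; [:: 0;10;5;2;9]; [:: 1;4;9;5;10]; [:: 2;9;0;4;5];
      [:: 0;10;4;2;5]; [:: 1;9;0;2;4]; [:: 1;5;0;3;10]; [:: 5;9;0;2;10];
      [:: 1;5;2;3;4]; [:: 0;2;9;5;10]]);
    (false, 2, 9, 10, [:: 1;2;3;4;5;6],
     [::
      [:: 1;5;3;4;6]; [:: 1;4;6;3;5]; [:: 2;3;6;4;5]; [:: 2;3;6;1;5];
      [:: 2;5;3;4;6]; [:: 1;5;6;3;4]; [:: 1;2;6;3;5]; [:: 3;5;2;1;6];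
      [:: 1;2;6;4;5]; [:: 1;2;3;5;6]]);
    (false, 2, 7, 8, [:: 1;2;3;4;5;6],
     [::
      [:: 2;5;4;3;6]; [:: 1;5;4;3;6]; [:: 1;2;5;4;6]; [:: 1;3;2;4;5];
      [:: 2;5;3;1;4]; [:: 2;3;6;4;5]; [:: 3;5;2;1;6]; [:: 3;5;2;4;6];
      [:: 1;3;5;4;6]; [:: 1;5;2;3;4]; [:: 3;5;1;2;6]])]).
- by vm_compute.
- exact: (tight_uniq tight_b ws_uniq ws_W).
- by [].
by rewrite /= nj Nst Nxy (tight_red tight_b ws_W).
Qed.

Lemma spares_join_triangle_ends x y s t :
  uniq [:: x; y; s; t] -> {subset [:: x; y; s; t] <= W} ->
  c [set v in [:: u; b2; x; t]] = false ->
  c [set v in [:: u; b5; x; t]] = false ->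
  ~~ joined c false 2 [:: b1; b2; b3; b4; b5; g] x s ->
  joined c false 2 [:: u; b1; b2; b3; b4; b5; s; t] x y.
Proof.
move=> ws_uniq ws_W bl1 bl2 Nxs; apply: contraT => nj; exfalso.
apply: (@refutation _ c u [:: u; b1; b2; b3; b4; b5; g; x; y; s; t]
  [:: ([:: 0;2;7;10], false); ([:: 0;5;7;10], false)] [::
    (true, 3, 0, 6, [:: 1;2;3;4;5;7;8;9;10],
     [::
      [:: 1;4;8;9;10;2;3;7]; [:: 1;3;8;2;10;9;4;5]]);
    (false, 2, 7, 8, [:: 0;1;2;3;4;5;9;10],
     [::
      [:: 0;5;10;2;9]; [:: 2;10;0;1;3]; [:: 5;10;0;1;4]]);
    (false, 2, 7, 9, [:: 1;2;3;4;5;6],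
     [::
      [:: 2;3;6;4;5]])]).
- by vm_compute.
- exact: (tight_uniq tight_b ws_uniq ws_W).
- by rewrite /= bl1 bl2.
by rewrite /= nj Nxs (tight_red tight_b ws_W).
Qed.

Lemma spares_join_ends x y s t d :
  uniq [:: x; y; s; t; d] -> {subset [:: x; y; s; t; d] <= W} ->
  c [set v in [:: u; b4; y; t]] = false ->
  c [set v in [:: u; b1; y; t]] = false ->
  c [set v in [:: u; b3; y; t]] = false ->
  ~~ joined c false 2 [:: b1; b2; b3; b4; b5; g] s d ->
  joined c false 2 [:: u; b1; b2; b3; b4; b5; s; t] x y.
Proof.
move=> ws_uniq ws_W bl1 bl2 bl3 Nsd; apply: contraT => nj; exfalso.
apply: (@refutation _ c u [:: u; b1; b2; b3; b4; b5; g; x; y; s; t; d]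
  [:: ([:: 0;4;8;10], false); ([:: 0;1;8;10], false); ([:: 0;3;8;10], false)] [::
    (true, 3, 0, 6, [:: 1;2;3;4;5;7;8;9;10;11],
     [::
      [:: 2;3;7;4;10;9;1;5]; [:: 1;2;7;9;10;4;3;11]]);
    (false, 2, 7, 8, [:: 0;1;2;3;4;5;9;10],
     [::
      [:: 1;2;0;3;10]; [:: 4;9;10;0;1]; [:: 2;3;0;4;10]]);
    (false, 2, 9, 11, [:: 1;2;3;4;5;6],
     [::
      [:: 1;5;6;3;4]])]).
- by vm_compute.
- exact: (tight_uniq tight_b ws_uniq ws_W).
- by rewrite /= bl1 bl2 bl3.
by rewrite /= nj Nsd (tight_red tight_b ws_W).
Qed.

Lemma spares_join_spares x y s t d :
  uniq [:: x; y; s; t; d] -> {subset [:: x; y; s; t; d] <= W} ->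
  c [set v in [:: u; b1; y; s]] = false ->
  c [set v in [:: u; b2; y; t]] = false ->
  ~~ joined c false 2 [:: b1; b2; b3; b4; b5; g] s t ->
  joined c false 2 [:: u; b1; b2; b3; b4; b5; s; t] x y.
Proof.
move=> ws_uniq ws_W bl1 bl2 Nst; apply: contraT => nj; exfalso.
apply: (@refutation _ c u [:: u; b1; b2; b3; b4; b5; g; x; y; s; t; d]
  [:: ([:: 0;1;8;9], false); ([:: 0;2;8;10], false)] [::
    (true, 3, 0, 6, [:: 1;2;3;4;5;7;8;9;10;11],
     [::
      [:: 1;5;7;3;9;10;2;4]; [:: 4;10;7;2;3;5;1;9]]);
    (false, 2, 7, 8, [:: 0;1;2;3;4;5;9;10],
     [::
      [:: 3;9;10;0;2]; [:: 1;5;0;2;10]; [:: 3;5;2;0;10]; [:: 4;10;0;1;9]]);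
    (false, 2, 9, 10, [:: 1;2;3;4;5;6],
     [::
      [:: 1;5;6;2;4]])]).
- by vm_compute.
- exact: (tight_uniq tight_b ws_uniq ws_W).
- by rewrite /= bl1 bl2.
by rewrite /= nj Nst (tight_red tight_b ws_W).
Qed.

(** In this and the next four lemmas the unjoined pairs refer to the pool that misses [g]. Two red
    edges containing [g] and [b1] are candidates for the last edge of a forbidden red path; the
    cases are distinguished by how two or three unjoined pairs meet each other and the outside
    vertices [x], [y] of these edges. *)
Lemma two_red_triangle x a b d :
  uniq [:: x; a; b; d] -> {subset [:: x; a; b; d] <= W} ->
  c [set v in [:: g; b1; b2; x]] = true ->
  c [set v in [:: g; b1; b3; x]] = true ->
  ~~ joined c false 2 [:: u; b1; b2; b3; b4; b5] a b ->
  ~~ joined c false 2 [:: u; b1; b2; b3; b4; b5] a d ->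
  ~~ joined c false 2 [:: u; b1; b2; b3; b4; b5] b d ->
  False.
Proof.
move=> ws_uniq ws_W rx rx1 Nab Nad Nbd.
apply: (@refutation _ c u [:: u; b1; b2; b3; b4; b5; g; x; a; b; d]
  [:: ([:: 6;1;2;7], true); ([:: 6;1;3;7], true)] [::
    (true, 3, 0, 6, [:: 1;2;3;4;5;7;8;9;10],
     [::
      [:: 5;9;3;4;10;1;2;7]; [:: 5;8;4;3;9;2;1;7]; [:: 4;10;2;5;9;3;1;7];
      [:: 4;8;5;2;10;1;3;7]]);
    (false, 2, 8, 9, [:: 0;1;2;3;4;5],
     [::
      [:: 0;4;5;2;3]]);
    (false, 2, 8, 10, [:: 0;1;2;3;4;5],
     [::
      [:: 0;5;4;1;3]]);
    (false, 2, 9, 10, [:: 0;1;2;3;4;5],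
     [::
      [:: 3;4;2;1;5]; [:: 3;5;0;2;4]])]).
- by vm_compute.
- exact: (tight_uniq tight_b ws_uniq ws_W).
- by rewrite /= rx rx1.
by rewrite /= Nab Nad Nbd (tight_red tight_b ws_W).
Qed.

Lemma two_red_pairs x a b d e :
  uniq [:: x; a; b; d; e] -> {subset [:: x; a; b; d; e] <= W} ->
  c [set v in [:: g; b1; b2; x]] = true ->
  c [set v in [:: g; b1; b3; x]] = true ->
  ~~ joined c false 2 [:: u; b1; b2; b3; b4; b5] a b ->
  ~~ joined c false 2 [:: u; b1; b2; b3; b4; b5] d e ->
  False.
Proof.
move=> ws_uniq ws_W rx rx1 Nab Nde.
apply: (@refutation _ c u [:: u; b1; b2; b3; b4; b5; g; x; a; b; d; e]
  [:: ([:: 6;1;2;7], true); ([:: 6;1;3;7], true)] [::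
    (true, 3, 0, 6, [:: 1;2;3;4;5;7;8;9;10;11],
     [::
      [:: 2;10;4;5;8;3;1;7]; [:: 3;9;4;5;11;1;2;7]; [:: 4;10;2;5;9;1;3;7];
      [:: 2;8;5;4;11;1;3;7]]);
    (false, 2, 8, 9, [:: 0;1;2;3;4;5],
     [::
      [:: 3;4;5;1;2]; [:: 2;5;0;3;4]]);
    (false, 2, 10, 11, [:: 0;1;2;3;4;5],
     [::
      [:: 0;2;4;1;5]])]).
- by vm_compute.
- exact: (tight_uniq tight_b ws_uniq ws_W).
- by rewrite /= rx rx1.
by rewrite /= Nab Nde (tight_red tight_b ws_W).
Qed.

Lemma two_red_both x y a b :
  uniq [:: x; y; a; b] -> {subset [:: x; y; a; b] <= W} ->
  c [set v in [:: g; b1; b2; x]] = true ->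
  c [set v in [:: g; b1; b3; y]] = true ->
  ~~ joined c false 2 [:: u; b1; b2; b3; b4; b5] x y ->
  ~~ joined c false 2 [:: u; b1; b2; b3; b4; b5] a b ->
  False.
Proof.
move=> ws_uniq ws_W rx ry Nxy Nab.
apply: (@refutation _ c u [:: u; b1; b2; b3; b4; b5; g; x; y; a; b]
  [:: ([:: 6;1;3;8], true); ([:: 6;1;2;7], true)] [::
    (true, 3, 0, 6, [:: 1;2;3;4;5;7;8;9;10],
     [::
      [:: 2;7;5;4;9;1;3;8]; [:: 4;8;3;5;10;2;1;7]; [:: 2;10;4;5;7;1;3;8];
      [:: 3;8;4;5;9;1;2;7]]);
    (false, 2, 7, 8, [:: 0;1;2;3;4;5],
     [::
      [:: 2;5;0;3;4]; [:: 1;5;4;0;3]]);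
    (false, 2, 9, 10, [:: 0;1;2;3;4;5],
     [::
      [:: 1;5;4;0;2]; [:: 1;4;5;2;3]])]).
- by vm_compute.
- exact: (tight_uniq tight_b ws_uniq ws_W).
- by rewrite /= rx ry.
by rewrite /= Nxy Nab (tight_red tight_b ws_W).
Qed.

Lemma two_red_one x y a b d :
  uniq [:: x; y; a; b; d] -> {subset [:: x; y; a; b; d] <= W} ->
  c [set v in [:: g; b1; b2; x]] = true ->
  c [set v in [:: g; b1; b3; y]] = true ->
  ~~ joined c false 2 [:: u; b1; b2; b3; b4; b5] x d ->
  ~~ joined c false 2 [:: u; b1; b2; b3; b4; b5] a b ->
  False.
Proof.
move=> ws_uniq ws_W rx ry Nxd Nab.
apply: (@refutation _ c u [:: u; b1; b2; b3; b4; b5; g; x; y; a; b; d]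
  [:: ([:: 6;1;2;7], true); ([:: 6;1;3;8], true)] [::
    (true, 3, 0, 6, [:: 1;2;3;4;5;7;8;9;10;11],
     [::
      [:: 5;7;4;2;10;3;1;8]; [:: 4;10;3;5;11;1;2;7]; [:: 2;10;5;4;9;1;3;8];
      [:: 4;7;5;2;9;1;3;8]; [:: 4;9;3;5;11;1;2;7]]);
    (false, 2, 7, 11, [:: 0;1;2;3;4;5],
     [::
      [:: 0;4;5;1;3]]);
    (false, 2, 9, 10, [:: 0;1;2;3;4;5],
     [::
      [:: 3;4;0;2;5]; [:: 1;5;2;3;4]; [:: 1;5;4;0;3]])]).
- by vm_compute.
- exact: (tight_uniq tight_b ws_uniq ws_W).
- by rewrite /= rx ry.
by rewrite /= Nxd Nab (tight_red tight_b ws_W).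
Qed.

Lemma two_red_none x y a b d e :
  uniq [:: x; y; a; b; d; e] -> {subset [:: x; y; a; b; d; e] <= W} ->
  c [set v in [:: g; b1; b2; x]] = true ->
  c [set v in [:: g; b1; b3; y]] = true ->
  ~~ joined c false 2 [:: u; b1; b2; b3; b4; b5] d e ->
  ~~ joined c false 2 [:: u; b1; b2; b3; b4; b5] a b ->
  False.
Proof.
move=> ws_uniq ws_W rx ry Nde Nab.
apply: (@refutation _ c u [:: u; b1; b2; b3; b4; b5; g; x; y; a; b; d; e]
  [:: ([:: 6;1;3;8], true); ([:: 6;1;2;7], true)] [::
    (true, 3, 0, 6, [:: 1;2;3;4;5;7;8;9;10;11;12],
     [::
      [:: 5;9;2;4;11;1;3;8]; [:: 3;12;5;4;10;1;2;7]; [:: 2;11;4;5;10;1;3;8];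
      [:: 2;9;5;4;12;3;1;8]]);
    (false, 2, 11, 12, [:: 0;1;2;3;4;5],
     [::
      [:: 1;2;4;3;5]; [:: 2;4;0;3;5]]);
    (false, 2, 9, 10, [:: 0;1;2;3;4;5],
     [::
      [:: 0;2;5;1;4]])]).
- by vm_compute.
- exact: (tight_uniq tight_b ws_uniq ws_W).
- by rewrite /= rx ry.
by rewrite /= Nde Nab (tight_red tight_b ws_W).
Qed.

End Block.

(** * Configurations around a segment of one edge *)

Section Single.
Variables (u b1 b2 g : V) (W : seq V).
Hypothesis tight_b : tight 2 u [:: b1; b2] g W.

(** For [k = 1] an unjoined pair forms a red edge with any two vertices of the pool. The red edges
    on [u, b2, y, x] and on [x, b1, z, g] meet in [x] and make a forbidden path. In the next two
    lemmas the hinge is [b1], respectively [b2]. *)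
Lemma entry_exit_share x y z :
  uniq [:: x; y; z] -> {subset [:: x; y; z] <= W} ->
  ~~ joined c false 1 [:: u; b1; b2] x y ->
  ~~ joined c false 1 [:: b1; b2; g] x z ->
  False.
Proof.
move=> ws_uniq ws_W N1 N2.
apply: (@refutation _ c u [:: u; b1; b2; g; x; y; z]
  [::] [::
    (true, 2, 0, 3, [:: 1;2;4;5;6],
     [::
      [:: 2;5;4;1;6]]);
    (false, 1, 4, 5, [:: 0;1;2],
     [::
      [:: 0;2]]);
    (false, 1, 4, 6, [:: 1;2;3],
     [::
      [:: 1;3]])]).
- by vm_compute.
- exact: (tight_uniq tight_b ws_uniq ws_W).
- by [].
by rewrite /= N1 N2 (tight_red tight_b ws_W).
Qed.

Lemma entry_exit_apart x y z w :
  uniq [:: x; y; z; w] -> {subset [:: x; y; z; w] <= W} ->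
  ~~ joined c false 1 [:: u; b1; b2] x y ->
  ~~ joined c false 1 [:: b1; b2; g] z w ->
  False.
Proof.
move=> ws_uniq ws_W N1 N2.
apply: (@refutation _ c u [:: u; b1; b2; g; x; y; z; w]
  [::] [::
    (true, 2, 0, 3, [:: 1;2;4;5;6;7],
     [::
      [:: 4;5;1;6;7]]);
    (false, 1, 4, 5, [:: 0;1;2],
     [::
      [:: 0;1]]);
    (false, 1, 6, 7, [:: 1;2;3],
     [::
      [:: 1;3]])]).
- by vm_compute.
- exact: (tight_uniq tight_b ws_uniq ws_W).
- by [].
by rewrite /= N1 N2 (tight_red tight_b ws_W).
Qed.

Lemma entry_mixed_apart x y z w :
  uniq [:: x; y; z; w] -> {subset [:: x; y; z; w] <= W} ->
  ~~ joined c false 1 [:: u; b1; b2] x y ->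
  ~~ joined c false 1 [:: u; b2; g] z w ->
  False.
Proof.
move=> ws_uniq ws_W N1 N2.
apply: (@refutation _ c u [:: u; b1; b2; g; x; y; z; w]
  [::] [::
    (true, 2, 0, 3, [:: 1;2;4;5;6;7],
     [::
      [:: 4;5;2;6;7]]);
    (false, 1, 4, 5, [:: 0;1;2],
     [::
      [:: 0;2]]);
    (false, 1, 6, 7, [:: 0;2;3],
     [::
      [:: 2;3]])]).
- by vm_compute.
- exact: (tight_uniq tight_b ws_uniq ws_W).
- by [].
by rewrite /= N1 N2 (tight_red tight_b ws_W).
Qed.

(** Two blue edges have five vertices between their ends, one more than a one-edge segment offers
    with its entry. Three vertices [p, q, r] of [W] are added to one half of the segment; here and
    in the next two lemmas both halves are assumed to fail, on pairs that coincide, share a vertex,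
    or are disjoint. *)
Lemma double_same x y p q r :
  uniq [:: x; y; p; q; r] -> {subset [:: x; y; p; q; r] <= W} ->
  ~~ joined c false 2 [:: u; b1; p; q; r] x y ->
  ~~ joined c false 2 [:: b2; g; p; q; r] x y ->
  False.
Proof.
move=> ws_uniq ws_W N1 N2.
apply: (@refutation _ c u [:: u; b1; b2; g; x; y; p; q; r]
  [::] [::
    (true, 2, 0, 3, [:: 1;2;4;5;6;7;8],
     [::
      [:: 1;6;4;2;7]; [:: 1;4;6;5;8]; [:: 1;6;5;2;7]; [:: 5;7;8;4;6];
      [:: 4;8;7;2;5]]);
    (false, 2, 4, 5, [:: 0;1;6;7;8],
     [::
      [:: 1;6;0;7;8]; [:: 7;8;0;1;6]]);
    (false, 2, 4, 5, [:: 2;3;6;7;8],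
     [::
      [:: 2;7;3;6;8]; [:: 6;8;3;2;7]])]).
- by vm_compute.
- exact: (tight_uniq tight_b ws_uniq ws_W).
- by [].
by rewrite /= N1 N2 (tight_red tight_b ws_W).
Qed.

Lemma double_share x y z p q r :
  uniq [:: x; y; z; p; q; r] -> {subset [:: x; y; z; p; q; r] <= W} ->
  ~~ joined c false 2 [:: u; b1; p; q; r] x y ->
  ~~ joined c false 2 [:: b2; g; p; q; r] x z ->
  False.
Proof.
move=> ws_uniq ws_W N1 N2.
apply: (@refutation _ c u [:: u; b1; b2; g; x; y; z; p; q; r]
  [::] [::
    (true, 2, 0, 3, [:: 1;2;4;5;6;7;8;9],
     [::
      [:: 5;8;9;2;4]; [:: 5;9;8;6;7]; [:: 1;7;4;2;9]; [:: 1;4;7;6;8]]);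
    (false, 2, 4, 5, [:: 0;1;7;8;9],
     [::
      [:: 1;7;0;8;9]]);
    (false, 2, 4, 6, [:: 2;3;7;8;9],
     [::
      [:: 2;9;3;7;8]])]).
- by vm_compute.
- exact: (tight_uniq tight_b ws_uniq ws_W).
- by [].
by rewrite /= N1 N2 (tight_red tight_b ws_W).
Qed.

Lemma double_apart x y z w p q r :
  uniq [:: x; y; z; w; p; q; r] -> {subset [:: x; y; z; w; p; q; r] <= W} ->
  ~~ joined c false 2 [:: u; b1; p; q; r] x y ->
  ~~ joined c false 2 [:: b2; g; p; q; r] z w ->
  False.
Proof.
move=> ws_uniq ws_W N1 N2.
apply: (@refutation _ c u [:: u; b1; b2; g; x; y; z; w; p; q; r]
  [::] [::
    (true, 2, 0, 3, [:: 1;2;4;5;6;7;8;9;10],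
     [::
      [:: 4;10;8;2;7]; [:: 5;9;10;7;8]; [:: 1;5;9;2;6]; [:: 4;8;10;6;9];
      [:: 1;4;8;7;10]]);
    (false, 2, 4, 5, [:: 0;1;8;9;10],
     [::
      [:: 1;8;0;9;10]; [:: 8;10;0;1;9]]);
    (false, 2, 6, 7, [:: 2;3;8;9;10],
     [::
      [:: 2;9;3;8;10]; [:: 9;10;3;2;8]])]).
- by vm_compute.
- exact: (tight_uniq tight_b ws_uniq ws_W).
- by [].
by rewrite /= N1 N2 (tight_red tight_b ws_W).
Qed.

End Single.

End Tight.

(** * Pairs of outside vertices joined through one segment *)

Section Segments.
Variables (V : finType) (c : {set V} -> bool).
Implicit Types (u g x y z w : V) (s W A : seq V).

Lemma joined_eq b k (P Q : seq V) x y : P =i Q -> joined c b k P x y = joined c b k Q x y.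
Proof. by move=> eqPQ; apply/idP/idP; apply: joined_sub => z; rewrite eqPQ. Qed.

(** Holding for [A = [:: b]] with every [b], it says that the graph [N] on [W] is not a star. *)
Definition avoidable (N : rel V) W A : Prop :=
  exists x y, [/\ x \in W, y \in W, x != y & N x y] /\ (x \notin A) && (y \notin A).

Definition unjoined k (P : seq V) : rel V := fun x y => ~~ joined c false k P x y.

Lemma unjoined_sym k P x y : 0 < k -> unjoined k P x y = unjoined k P y x.
Proof. by move=> k_gt0; rewrite /unjoined joined_sym. Qed.

(** That is, [z] and [w] form a vertex cover of the graph [N] on [W]. *)
Definition hits (N : rel V) W z w : bool :=
  [forall x, forall y, [&& x \in W, y \in W, x != y & N x y] ==>
     (z \in [:: x; y]) || (w \in [:: x; y])].

Lemma hitsPn (N : rel V) W z w :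
  ~~ hits N W z w ->
  exists x y, [/\ x \in W, y \in W, x != y & N x y] /\
              (z \notin [:: x; y]) && (w \notin [:: x; y]).
Proof.
case/forallPn=> x /forallPn[y]; rewrite negb_imply negb_or => /andP[/and4P[xW yW xy Nxy] zw].
by exists x, y.
Qed.

Lemma hitsP (N : rel V) W z w x y :
  hits N W z w -> x \in W -> y \in W -> x != y -> N x y ->
  (z \in [:: x; y]) || (w \in [:: x; y]).
Proof.
by move=> /forallP/(_ x)/forallP/(_ y)/implyP h xW yW xy Nxy; apply: h; rewrite xW yW xy.
Qed.

(** If [z] and [w] are no cover, some unjoined pair is disjoint from them, and [entry_blue] applies
    after [v] is moved to the front of the segment. *)
Lemma entry_blue_seq u s g W z w v :
  size s = 5 -> tight c 3 u s g W -> v \in s ->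
  z \in W -> w \in W -> z != w -> ~~ hits (unjoined 2 (rcons s g)) W z w ->
  c [set i in [:: u; v; z; w]] = false.
Proof.
move=> sz tg vs zW wW zw /hitsPn[x [y [[xW yW xy Nxy]]]].
rewrite !inE !negb_or => /andP[/andP[zx zy] /andP[wx wy]].
have sv := perm_to_rem vs; have := perm_size sv; rewrite sz /= => -[].
case E: (rem v s) => [|v1 [|v2 [|v3 [|v4 [|? ?]]]]] // _.
rewrite E in sv; have tg' := tight_perm sv tg.
apply: (entry_blue tg' (x := x) (y := y)).
- by rewrite /= !inE !negb_or xy zw ![x == _]eq_sym ![y == _]eq_sym zx zy wx wy.
- by move=> i; rewrite !inE => /or4P[]/eqP->.
apply: contra Nxy; apply: joined_sub => i.
by rewrite mem_rcons inE (perm_mem sv) !inE; do 6!case: (i == _).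
Qed.

(** * Closing the blue cycle through a two-edge segment with two spare vertices *)

Section BlockClosing.
Variables (u g : V) (s W : seq V).
Hypotheses (size_s : size s = 5) (tight_s : tight c 3 u s g W).
Let N := unjoined 2 (rcons s g).
Hypothesis not_star : forall b, avoidable N W [:: b].

Let Nsym x y : N x y = N y x. Proof. exact: unjoined_sym. Qed.

Let nb x y p q := ~~ joined c false 2 (u :: s ++ [:: p; q]) x y.

Let nb_swap x y p q : nb x y p q -> nb x y q p.
Proof.
apply: contra; apply: joined_sub => i.
by rewrite !inE !mem_cat !inE (orbC (i == p)).
Qed.

Let nb_rev x y p q : nb x y p q -> nb y x p q.
Proof. by rewrite /nb joined_sym. Qed.

Let pairs x y p q :
  uniq [:: x; y; p; q] -> {subset [:: x; y; p; q] <= W} -> nb x y p q ->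
  N p q -> N x y -> False.
Proof.
rewrite /N /nb; move: tight_s size_s; case: (s) => [|b1 [|b2 [|b3 [|b4 [|b5 [|? ?]]]]]] //.
move=> tg _ un sW nj N1 N2; move/negP: nj; apply.
exact: (spares_join_pairs tg un sW).
Qed.

Let blue z w x y v : N x y -> x != y -> x \in W -> y \in W -> z \in W -> w \in W ->
  uniq [:: x; y; z; w] -> v \in s -> c [set i in [:: u; v; z; w]] = false.
Proof.
move=> Nxy xy xW yW zW wW un vs; split_uniq un.
apply: (entry_blue_seq size_s tight_s vs) => //; apply/negP => /hitsP/(_ xW yW xy Nxy).
by rewrite !inE; use_neqs.
Qed.

(** The unjoined pair [x d] is disjoint from [y, p] and from [y, q], so all edges made of [u], a
    vertex of [s] and one of these pairs are blue. *)
Let outside x y p q d :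
  uniq [:: x; y; p; q] -> {subset [:: x; y; p; q] <= W} -> nb x y p q ->
  d \in W -> d != x -> d != p -> d != q -> N p q -> N x d -> False.
Proof.
move=> un sW nj dW dx dp dq Npq Nxd.
have [dy|dy] := eqVneq d y; first by rewrite dy in Nxd; exact: (pairs un sW nj Npq Nxd).
have [xW yW pW qW] : [/\ x \in W, y \in W, p \in W & q \in W].
  by split; apply: sW; rewrite !inE eqxx ?orbT.
have un5 : uniq [:: x; y; p; q; d] by split_uniq un; distinct.
have blp v : v \in s -> c [set i in [:: u; v; y; p]] = false.
  by apply: (blue Nxd) => //; split_uniq un5; distinct.
have blq v : v \in s -> c [set i in [:: u; v; y; q]] = false.
  by apply: (blue Nxd) => //; split_uniq un5; distinct.
move: tight_s size_s nj Npq blp blq; rewrite /N /nb.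
case: (s) => [|b1 [|b2 [|b3 [|b4 [|b5 [|? ?]]]]]] //.
move=> tg _ nj Npq blp blq; move/negP: nj; apply.
apply: (spares_join_spares tg un5) => //.
- by move=> i; rewrite !inE => /or4P[/eqP->|/eqP->|/eqP->|/orP[]/eqP->].
- by apply: blp; rewrite !inE eqxx ?orbT.
- by apply: blq; rewrite !inE eqxx ?orbT.
Qed.

(** An unjoined pair avoiding [x] must be [p q]. Pairs avoiding [p], respectively [q], must contain
    [x]; unless one of them has its other end outside, they complete the triangle [x p q]. *)
Let hub x y p q :
  uniq [:: x; y; p; q] -> {subset [:: x; y; p; q] <= W} -> nb x y p q ->
  hits N W x p -> hits N W x q -> False.
Proof.
move=> un sW nj hxp hxq.
have [xW yW pW qW] : [/\ x \in W, y \in W, p \in W & q \in W].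
  by split; apply: sW; rewrite !inE eqxx ?orbT.
have un' := un; split_uniq un'.
have Npq : N p q.
  have [a [b [[aW bW ab Nab]]]] := not_star x; rewrite !inE => /andP[ax bx].
  have := hitsP hxp aW bW ab Nab; have := hitsP hxq aW bW ab Nab; rewrite !inE; use_neqs => /=.
  have pq : p != q by distinct.
  case/orP=> /eqP qE; case/orP=> /eqP pE; rewrite qE pE ?eqxx // in pq *.
  by rewrite Nsym.
have arm p' : hits N W x p' -> exists d, [/\ d \in W, d != x, d != p' & N x d].
  move=> h; have [a [b [[aW bW ab Nab]]]] := not_star p'; rewrite !inE => /andP[ap bp].
  have := hitsP h aW bW ab Nab; rewrite !inE; use_neqs => /=; rewrite orbF.
  case/orP=> /eqP xE.
    by exists b; rewrite xE eq_sym.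
  by exists a; rewrite xE Nsym.
have [d [dW dx dp Nxd]] := arm p hxp; have [e [eW ex eq Nxe]] := arm q hxq.
have [dq|dq] := eqVneq d q; last exact: (outside un sW nj dW dx dp dq Npq Nxd).
have [ep|ep] := eqVneq e p; last exact: (outside un sW nj eW ex ep eq Npq Nxe).
rewrite dq in Nxd; rewrite ep in Nxe.
have blp v : v \in s -> c [set i in [:: u; v; y; p]] = false.
  by apply: (blue Nxd) => //; distinct.
have blq v : v \in s -> c [set i in [:: u; v; y; q]] = false.
  by apply: (blue Nxe) => //; distinct.
move: tight_s size_s nj Npq Nxd Nxe blp blq; rewrite /N /nb.
case: (s) => [|b1 [|b2 [|b3 [|b4 [|b5 [|? ?]]]]]] //.
move=> tg _ nj Npq Nxd Nxe blp blq; move/negP: nj; apply.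
apply: (spares_join_triangle tg un) => //.
- by apply: blq; rewrite !inE eqxx ?orbT.
- by apply: blp; rewrite !inE eqxx ?orbT.
Qed.

(** An unjoined pair avoiding [p] must be [x y]. Pairs avoiding [x], respectively [y], must contain
    [p]; either one leaves the set [x, y, p], or they complete the triangle on it. *)
Let bridge x y p q :
  uniq [:: x; y; p; q] -> {subset [:: x; y; p; q] <= W} -> nb x y p q ->
  hits N W x p -> hits N W y p -> False.
Proof.
move=> un sW nj hxp hyp.
have [xW yW pW qW] : [/\ x \in W, y \in W, p \in W & q \in W].
  by split; apply: sW; rewrite !inE eqxx ?orbT.
have un' := un; split_uniq un'.
have Nxy : N x y.
  have [a [b [[aW bW ab Nab]]]] := not_star p; rewrite !inE => /andP[ap bp].
  have := hitsP hxp aW bW ab Nab; have := hitsP hyp aW bW ab Nab; rewrite !inE; use_neqs => /=; rewrite !orbF.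
  have xy : x != y by distinct.
  case/orP=> /eqP yE; case/orP=> /eqP xE; rewrite yE xE ?eqxx // in xy *.
  by rewrite Nsym.
have arm x' : hits N W x' p -> exists d, [/\ d \in W, d != p, d != x' & N p d].
  move=> h; have [a [b [[aW bW ab Nab]]]] := not_star x'; rewrite !inE => /andP[ap bp].
  have := hitsP h aW bW ab Nab; rewrite !inE; use_neqs => /=.
  case/orP=> /eqP xE.
    by exists b; rewrite xE eq_sym.
  by exists a; rewrite xE Nsym.
have far d : d \in W -> d != p -> d != x -> d != y -> N p d -> False.
  move=> dW dp dx dy Npd.
  have [dq|dq] := eqVneq d q; first by rewrite dq in Npd; exact: (pairs un sW nj Npd Nxy).
  have un5 : uniq [:: x; y; p; q; d] by distinct.
  have blq v : v \in s -> c [set i in [:: u; v; y; q]] = false.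
    by apply: (blue Npd) => //; rewrite 1?eq_sym //; distinct.
  move: tight_s size_s nj Npd blq; rewrite /N /nb.
  case: (s) => [|b1 [|b2 [|b3 [|b4 [|b5 [|? ?]]]]]] //.
  move=> tg _ nj Npd blq; move/negP: nj; apply.
  apply: (spares_join_ends tg un5) => //.
  - by move=> i; rewrite !inE => /or4P[/eqP->|/eqP->|/eqP->|/orP[]/eqP->].
  - by apply: blq; rewrite !inE eqxx ?orbT.
  - by apply: blq; rewrite !inE eqxx ?orbT.
  - by apply: blq; rewrite !inE eqxx ?orbT.
have [d [dW dp dx Npd]] := arm x hxp; have [e [eW ep ey Npe]] := arm y hyp.
have [dy|dy] := eqVneq d y; last exact: (far d).
have [ex|ex] := eqVneq e x; last exact: (far e).
rewrite dy in Npd; rewrite ex in Npe.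
have blq v : v \in s -> c [set i in [:: u; v; x; q]] = false.
  by apply: (blue Npd) => //; rewrite 1?eq_sym //; distinct.
have Nxp : N x p by rewrite Nsym.
move: tight_s size_s nj Nxp blq; rewrite /N /nb.
case: (s) => [|b1 [|b2 [|b3 [|b4 [|b5 [|? ?]]]]]] //.
move=> tg _ nj Nxp blq; move/negP: nj; apply.
apply: (spares_join_triangle_ends tg un) => //.
- by apply: blq; rewrite !inE eqxx ?orbT.
- by apply: blq; rewrite !inE eqxx ?orbT.
Qed.

Lemma block_closing x y p q :
  uniq [:: x; y; p; q] -> {subset [:: x; y; p; q] <= W} ->
  joined c false 2 (u :: s ++ [:: p; q]) x y.
Proof.
move=> un sW; apply: contraT => nj; exfalso.
have [xW yW pW qW] : [/\ x \in W, y \in W, p \in W & q \in W].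
  by split; apply: sW; rewrite !inE eqxx ?orbT.
(* If neither pair is a cover, two blue edges meeting in [u], one through [x] and [p'], the other
   through [y] and [q'], already join [x] and [y]. *)
have link p' q' : (p' \in [:: p; q]) -> (q' \in [:: p; q]) -> p' != q' ->
    hits N W x p' || hits N W y q'.
  move=> p'pq q'pq pq'.
  apply: contraTT nj; rewrite negb_or => /andP[hx hy]; rewrite negbK.
  have [b1 [b2 [b1s b2s b12]]] : exists b1 b2, [/\ b1 \in s, b2 \in s & b1 != b2].
    move: tight_s size_s => /andP[+ _]; case: (s) => [|b1 [|b2 s']] //= /and3P[_ + _] _.
    by rewrite inE negb_or => /andP[? _]; exists b1, b2; rewrite !inE !eqxx orbT.
  have un4 : uniq [:: x; y; p'; q'].
    split_uniq un; move: p'pq q'pq pq'; rewrite !inE.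
    case/orP=> /eqP->; case/orP=> /eqP->; rewrite ?eqxx // => _; distinct.
  have s4W : {subset [:: x; y; p'; q'] <= W}.
    move=> i; rewrite !inE => /or4P[]/eqP-> //.
      by move: p'pq; rewrite !inE => /orP[]/eqP->.
    by move: q'pq; rewrite !inE => /orP[]/eqP->.
  have [p'W q'W] : p' \in W /\ q' \in W by split; apply: s4W; rewrite !inE eqxx ?orbT.
  split_uniq un4.
  have e1 : c [set i in [:: u; b1; x; p']] = false by apply: entry_blue_seq hx.
  have e2 : c [set i in [:: u; b2; y; q']] = false by apply: entry_blue_seq hy.
  apply/joinedP; exists [:: p'; b1; u; b2; q']; split=> //.
  - have : uniq (u :: s ++ g :: [:: x; y; p'; q']) by apply: tight_uniq tight_s _ s4W; distinct.
    have mem_ne v w : v \in s -> w \in [:: p'; q'] ->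
        uniq (u :: s ++ g :: [:: x; y; p'; q']) -> (v != w) && (u != v) && (u != w).
      move=> vs w4 /= /andP[]; rewrite mem_cat negb_or !inE => /andP[us] nu.
      rewrite cat_uniq => /and3P[_ /hasPn dis _]; apply/andP; split; first (apply/andP; split).
      - by apply: contraTneq vs => ->; apply: dis; move: w4; rewrite !inE => /orP[]->; rewrite ?orbT.
      - by apply: contraNneq us => ->.
      by apply: contraNneq nu => ->; move: w4; rewrite !inE => /orP[]->; rewrite ?orbT.
    move=> un7.
    have /andP[/andP[? ?] ?] := mem_ne b1 p' b1s (mem_head _ _) un7.
    have /andP[/andP[? ?] ?] : (b1 != q') && (u != b1) && (u != q').
      by apply: mem_ne => //; rewrite !inE eqxx orbT.
    have /andP[/andP[? ?] ?] := mem_ne b2 p' b2s (mem_head _ _) un7.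
    have /andP[/andP[? ?] ?] : (b2 != q') && (u != b2) && (u != q').
      by apply: mem_ne => //; rewrite !inE eqxx orbT.
    by distinct.
  - by move: p'pq q'pq; rewrite !inE => p'pq q'pq i; rewrite !inE !mem_cat !inE =>
      /or4P[/eqP->|/eqP->|/eqP->|/orP[]/eqP->]; rewrite ?eqxx ?b1s ?b2s ?p'pq ?q'pq ?orbT.
  - rewrite /= andbT; apply/andP; split; apply/eqP; [rewrite -e1 | rewrite -e2]; congr (c _);
      by apply: eq_set_seq => i; rewrite !inE; do 4!case: (i == _).
have un' := un; split_uniq un'.
have memp : p \in [:: p; q] by rewrite !inE eqxx.
have memq : q \in [:: p; q] by rewrite !inE eqxx orbT.
have un_yx : uniq [:: y; x; p; q] by distinct.
have un_qp : uniq [:: x; y; q; p] by distinct.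
have sub_yx : {subset [:: y; x; p; q] <= W} by move=> i; rewrite !inE => /or4P[]/eqP->.
have sub_qp : {subset [:: x; y; q; p] <= W} by move=> i; rewrite !inE => /or4P[]/eqP->.
have := link p q memp memq; have := link q p memq memp; rewrite eq_sym.
have -> : p != q by []; move=> /(_ isT) h1 /(_ isT) h2.
(* The two covers share one vertex: an end of the path gives [hub], a spare gives [bridge]. *)
case/orP: h1 => h1; case/orP: h2 => h2.
- exact: (hub un sW nj h2 h1).
- exact: (bridge un_qp sub_qp (nb_swap nj) h1 h2).
- exact: (bridge un sW nj h2 h1).
- exact: (hub un_yx sub_yx (nb_rev nj) h1 h2).
Qed.

End BlockClosing.

(** Without a cover of size two there are unjoined pairs off any two given vertices, and one of the
    configurations excluded above must appear. *)
Lemma two_red u g (W : seq V) b1 b2 b3 b4 b5 (P : seq V) x y :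
  tight c 3 u [:: b1; b2; b3; b4; b5] g W -> P =i [:: u; b1; b2; b3; b4; b5] ->
  (forall p q, ~~ hits (unjoined 2 P) W p q) -> x \in W -> y \in W ->
  c [set i in [:: g; b1; b2; x]] = true -> c [set i in [:: g; b1; b3; y]] = true -> False.
Proof.
move=> tg eqP no_cover xW yW rx ry.
have Nsym a b : unjoined 2 P a b = unjoined 2 P b a by apply: unjoined_sym.
have NP a b : unjoined 2 P a b -> ~~ joined c false 2 [:: u; b1; b2; b3; b4; b5] a b.
  by rewrite /unjoined (joined_eq _ _ _ _ eqP).
have free p q : exists a b, [/\ a \in W, b \in W, a != b & unjoined 2 P a b] /\
    [/\ p != a, p != b, q != a & q != b].
  have [a [b [h]]] := hitsPn (no_cover p q); rewrite !inE !negb_or.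
  by move=> /andP[/andP[? ?] /andP[? ?]]; exists a, b.
have memW (ws : seq V) : all (mem W) ws -> {subset ws <= W} by move=> /allP.
have [a [b [[aW bW ab Nab] [xa xb ya yb]]]] := free x y.
(* If [x = y], the unjoined pairs off [x] form no star, so two of them are disjoint or three of them
   form a triangle. *)
have [xy|xy] := eqVneq x y.
  subst y.
  have apart d e : d \in W -> e \in W -> d != e -> d != x -> e != x -> unjoined 2 P d e ->
      forall a b, a \in W -> b \in W -> a != b -> x != a -> x != b -> unjoined 2 P a b ->
      d != a -> d != b -> e != a -> e != b -> False.
    move=> dW eW de dx ex Nde a' b' a'W b'W ab' xa' xb' Nab' da db ea eb.
    apply: (two_red_pairs tg (x := x) (a := a') (b := b') (d := d) (e := e)) rx ry _ _.
    - by distinct.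
    - by apply: memW; rewrite /= xW a'W b'W dW eW.
    - exact: NP.
    - exact: NP.
  have arm v w : v \in W -> w \in W -> v != w -> x != v -> x != w -> unjoined 2 P v w ->
      exists d, [/\ d \in W, d != x, d != v, d != w & unjoined 2 P w d].
    move=> vW wW vw xv xw Nvw.
    have [d [e [[dW eW de Nde] [xd xe vd ve]]]] := free x v.
    have [wd|wd] := eqVneq w d.
      by subst d; exists e; split=> //; rewrite eq_sym.
    have [we|we] := eqVneq w e.
      by subst e; exists d; split=> //; rewrite 1?Nsym // eq_sym.
    by exfalso; apply: (apart d e dW eW de _ _ Nde v w) => //; distinct.
  have [d [dW dx da db Nbd]] := arm a b aW bW ab xa xb Nab.
  have ba : b != a by rewrite eq_sym.
  have [e [eW ex eb ea Nae]] := arm b a bW aW ba xb xa (etrans (Nsym _ _) Nab).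
  have [de|de] := eqVneq d e; last first.
    by apply: (apart b d bW dW _ _ _ Nbd a e) => //; distinct.
  subst e.
  apply: (two_red_triangle tg (x := x) (a := a) (b := b) (d := d)) rx ry _ _ _.
  - by distinct.
  - by apply: memW; rewrite /= xW aW bW dW.
  - exact: NP.
  - exact: NP.
  - exact: NP.
have tg' : tight c 3 u [:: b1; b3; b2; b4; b5] g W.
  by apply: tight_perm tg; reorder.
have eqP' : P =i [:: u; b1; b3; b2; b4; b5].
  by move=> i; rewrite eqP !inE; do 6!case: (i == _).
have [d [e [[dW eW de Nde] [ad ae bd be]]]] := free a b.
(* Handles a second pair [z f] that contains one of [x], [y]; exchanging [b2] and [b3] exchanges the
   two red edges. *)
have one z w f b2' b3' : tight c 3 u [:: b1; b2'; b3'; b4; b5] g W ->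
    P =i [:: u; b1; b2'; b3'; b4; b5] -> z \in W -> w \in W -> f \in W -> z != w ->
    c [set i in [:: g; b1; b2'; z]] = true -> c [set i in [:: g; b1; b3'; w]] = true ->
    z != a -> z != b -> w != a -> w != b -> f != a -> f != b -> f != z ->
    unjoined 2 P z f -> False.
  move=> tg2 eqP2 zW wW fW zw rz rw za zb wa wb fa fb fz Nzf.
  have NP2 a' b' : unjoined 2 P a' b' -> ~~ joined c false 2 [:: u; b1; b2'; b3'; b4; b5] a' b'.
    by rewrite /unjoined (joined_eq _ _ _ _ eqP2).
  have [fw|fw] := eqVneq f w.
    subst f; apply: (two_red_both tg2 (x := z) (y := w) (a := a) (b := b)) rz rw _ _.
    - by distinct.
    - by apply: memW; rewrite /= zW wW aW bW.
    - exact: NP2.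
    - exact: NP2.
  apply: (two_red_one tg2 (x := z) (y := w) (a := a) (b := b) (d := f)) rz rw _ _.
  - by distinct.
  - by apply: memW; rewrite /= zW wW aW bW fW.
  - exact: NP2.
  - exact: NP2.
have yx : y != x by rewrite eq_sym.
have [xd|xd] := eqVneq x d.
  by subst d; apply: (one _ _ _ _ _ tg eqP xW yW eW xy rx ry _ _ _ _ _ _ _ Nde); distinct.
have [xe|xe] := eqVneq x e.
  subst e; rewrite Nsym in Nde.
  by apply: (one _ _ _ _ _ tg eqP xW yW dW xy rx ry _ _ _ _ _ _ _ Nde); distinct.
have [yd|yd] := eqVneq y d.
  by subst d; apply: (one _ _ _ _ _ tg' eqP' yW xW eW yx ry rx _ _ _ _ _ _ _ Nde); distinct.
have [ye|ye] := eqVneq y e.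
  subst e; rewrite Nsym in Nde.
  by apply: (one _ _ _ _ _ tg' eqP' yW xW dW yx ry rx _ _ _ _ _ _ _ Nde); distinct.
apply: (two_red_none tg (x := x) (y := y) (a := a) (b := b) (d := d) (e := e)) rx ry _ _.
- by distinct.
- by apply: memW; rewrite /= xW yW aW bW dW eW.
- exact: NP.
- exact: NP.
Qed.

Definition joins_outside k (P : seq V) W A : Prop :=
  forall x y, x \in W -> y \in W -> x != y -> x \notin A -> y \notin A -> joined c false k P x y.

(** Either two vertices cover the pairs that the pool missing [g] leaves unjoined, and these are the
    exceptions with [g] as next entry; or there is no such cover, and the pool missing [b4] joins
    every pair. *)
Lemma block_middle u (s : seq V) g W :
  size s = 5 -> tight c 3 u s g W ->
  exists e A, [/\ e \in drop 3 (rcons s g), size A <= 2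
                & joins_outside 2 (rem e (u :: rcons s g)) W A].
Proof.
case: s => [|b1 [|b2 [|b3 [|b4 [|b5 [|? ?]]]]]] // _ tg.
have un : uniq [:: u; b1; b2; b3; b4; b5; g].
  by apply: (tight_uniq tg (ws := [::])).
have [cov|no_cov] := boolP [exists p, exists q, hits (unjoined 2 [:: u; b1; b2; b3; b4; b5]) W p q].
  have [p /existsP[q hpq]] := existsP cov.
  exists g, [:: p; q]; split=> //; first by rewrite !inE eqxx !orbT.
  move=> x y xW yW xy xA yA; apply: contraT => nj.
  have Nxy : unjoined 2 [:: u; b1; b2; b3; b4; b5] x y.
    have gn : g \notin [:: u; b1; b2; b3; b4; b5] by split_uniq un; distinct.
    apply: contra nj; apply: joined_sub => i i_in; rewrite mem_rem_uniq // inE /=.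
    rewrite -[X in _ && (i \in X)]/(rcons [:: u; b1; b2; b3; b4; b5] g) mem_rcons inE i_in orbT.
    by rewrite andbT; apply: contraTneq i_in => ->.
  have := hitsP hpq xW yW xy Nxy; move: xA yA; rewrite !inE !negb_or.
  by move=> /andP[? ?] /andP[? ?]; use_neqs.
have no_cover p q : ~~ hits (unjoined 2 [:: u; b1; b2; b3; b4; b5]) W p q.
  by apply: contra no_cov => h; apply/existsP; exists p; apply/existsP; exists q.
exists b4, [::]; split=> //; first by rewrite !inE eqxx.
move=> x y xW yW xy _ _; apply: contraT => nj; exfalso.
have un' := un; split_uniq un'.
(* Two blue edges meeting in the hinge [g] would join [x] and [y] without [b4], so one of the two is
   red. *)
have match_red v1 v2 v3 v4 : uniq [:: v1; v2; v3; v4; g] ->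
    {subset [:: v1; v2; v3; v4] <= [:: b1; b2; b3; b5]} ->
    c [set i in [:: g; v1; v2; x]] = true \/ c [set i in [:: g; v3; v4; y]] = true.
  move=> unv subv; case E1: (c [set i in [:: g; v1; v2; x]]); [by left|right].
  case E2: (c _) => //; case/negP: nj; apply/joinedP; exists [:: v1; v2; g; v3; v4].
  split=> //.
  - by split_uniq unv; distinct.
  - have sub4 i : i \in [:: b1; b2; b3; b5] -> i \in rem b4 [:: u; b1; b2; b3; b4; b5; g].
      by rewrite mem_rem_uniq // !inE => /or4P[]/eqP->; rewrite eqxx ?orbT andbT; distinct.
    have gin : g \in rem b4 [:: u; b1; b2; b3; b4; b5; g].
      by rewrite mem_rem_uniq // !inE eqxx !orbT andbT; distinct.
    by move=> i; rewrite !inE => /or4P[/eqP->|/eqP->|/eqP->|/orP[]/eqP->] //;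
       apply/sub4/subv; rewrite !inE eqxx ?orbT.
  by rewrite /= andbT; apply/andP; split; apply/eqP; [rewrite -E1 | rewrite -E2]; congr (c _);
    apply: eq_set_seq => i; rewrite !inE; do 4!case: (i == _).
have two v1 v2 v3 v4 x1 y1 : perm_eq [:: b1; b2; b3; b4; b5] [:: v1; v2; v3; v4; b4] ->
    x1 \in W -> y1 \in W ->
    c [set i in [:: g; v1; v2; x1]] = true -> c [set i in [:: g; v1; v3; y1]] = true -> False.
  move=> pm x1W y1W; apply: (two_red (tight_perm pm tg) _ no_cover) => //.
  by move=> i; rewrite inE (perm_mem pm) !inE.
have swap v1 v2 z : c [set i in [:: g; v1; v2; z]] = c [set i in [:: g; v2; v1; z]].
  by congr (c _); apply: eq_set_seq => i; rewrite !inE; do 4!case: (i == _).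
(* The splittings [b1 b2 | b3 b5] and [b1 b3 | b2 b5] are crossing: any part of one shares exactly
   one vertex with any part of the other, as [two_red] requires. *)
have m1 : c [set i in [:: g; b1; b2; x]] = true \/ c [set i in [:: g; b3; b5; y]] = true.
  by apply: match_red => //; distinct.
have m2 : c [set i in [:: g; b1; b3; x]] = true \/ c [set i in [:: g; b2; b5; y]] = true.
  apply: match_red; first by distinct.
  by move=> i; rewrite !inE => /or4P[]/eqP->; rewrite eqxx ?orbT.
case: m1 => [r12|r35]; case: m2 => [r13|r25].
- by apply: (two b1 b2 b3 b5 x x _ _ _ r12 r13) => //; reorder.
- by rewrite swap in r12; apply: (two b2 b1 b5 b3 x y _ _ _ r12 r25) => //; reorder.
- by rewrite swap in r13; apply: (two b3 b5 b1 b2 y x _ _ _ r35 r13) => //; reorder.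
- by rewrite swap in r35; rewrite swap in r25;
    apply: (two b5 b3 b2 b1 y y _ _ _ r35 r25) => //; reorder.
Qed.

(** Some pair left unjoined by the pool with exit [g] avoids [x]. Together with an unjoined pair
    [x y] it is impossible, whether it contains [y] or not. *)
Lemma single_closing u b1 b2 g W x y :
  tight c 2 u [:: b1; b2] g W ->
  (forall b, avoidable (unjoined 1 [:: b1; b2; g]) W [:: b]) ->
  x \in W -> y \in W -> x != y -> joined c false 1 [:: u; b1; b2] x y.
Proof.
move=> tg not_star xW yW xy; apply: contraT => nj; exfalso.
have [a [b [[aW bW ab Nab]]]] := not_star x; rewrite !inE => /andP[ax bx].
have share d : d \in W -> d != x -> d != y -> unjoined 1 [:: b1; b2; g] y d -> False.
  move=> dW dx dy Nyd; apply: (entry_exit_share tg (x := y) (y := x) (z := d)) Nyd.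
  - by distinct.
  - by move=> i; rewrite !inE => /or3P[]/eqP->.
  - by rewrite joined_sym.
have [ay|ay] := eqVneq a y; first by apply: (share b) => //; rewrite -?ay // eq_sym.
have [b_y|b_y] := eqVneq b y.
  by apply: (share a) => //; rewrite -b_y unjoined_sym.
apply: (entry_exit_apart tg (x := x) (y := y) (z := a) (w := b)) nj Nab.
- by distinct.
- by move=> i; rewrite !inE => /or4P[]/eqP->.
Qed.

Lemma joins_orP k (P : seq V) W :
  joins_outside k P W [::] \/ exists x y, [/\ x \in W, y \in W, x != y & unjoined k P x y].
Proof.
have [/existsP[x /existsP[y /and4P[]]]|none] :=
  boolP [exists x, exists y, [&& x \in W, y \in W, x != y & unjoined k P x y]].
  by right; exists x, y.
left=> x y xW yW xy _ _; apply: contraR none => nj.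
by apply/existsP; exists x; apply/existsP; exists y; rewrite xW yW xy.
Qed.

(** If the pool missing [g] fails on a pair [x y], then by [entry_mixed_apart] the pool missing [b1]
    fails on no pair disjoint from it. *)
Lemma single_middle u b1 b2 g W :
  tight c 2 u [:: b1; b2] g W ->
  exists e A, [/\ e \in [:: b1; b2; g], size A <= 2
                & joins_outside 1 (rem e [:: u; b1; b2; g]) W A].
Proof.
move=> tg; have un : uniq [:: u; b1; b2; g] by apply: (tight_uniq tg (ws := [::])).
have un' := un; split_uniq un'.
have [all_joined|[x [y [xW yW xy Nxy]]]] := joins_orP 1 [:: u; b1; b2] W.
  exists g, [::]; split=> //; first by rewrite !inE eqxx !orbT.
  move=> x y xW yW xy xA yA; apply: joined_sub (all_joined x y xW yW xy xA yA) => i.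
  by rewrite mem_rem_uniq // !inE => /or3P[]/eqP->; rewrite eqxx ?orbT andbT; distinct.
exists b1, [:: x; y]; split=> //; first by rewrite inE eqxx.
move=> z w zW wW zw; rewrite !inE !negb_or => /andP[zx zy] /andP[wx wy].
apply: contraT => nj; exfalso.
apply: (entry_mixed_apart tg (x := x) (y := y) (z := z) (w := w)) Nxy _.
- by distinct.
- by move=> i; rewrite !inE => /or4P[]/eqP->.
by apply: contra nj; apply: joined_sub => i; rewrite mem_rem_uniq // !inE;
  move=> /or3P[]/eqP->; rewrite eqxx ?orbT andbT; distinct.
Qed.

Lemma double_single u b1 b2 g W (T : seq V) p q r :
  tight c 2 u [:: b1; b2] g W -> uniq [:: p; q; r] -> {subset p :: q :: r :: T <= W} ->
  p \notin T -> q \notin T -> r \notin T ->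
  joins_outside 2 [:: u; b1; p; q; r] T [::] \/ joins_outside 2 [:: b2; g; p; q; r] T [::].
Proof.
move=> tg un sW pT qT rT.
have [|[x [y [xT yT xy Nxy]]]] := joins_orP 2 [:: u; b1; p; q; r] T; first by left.
right=> z w zT wT zw _ _; apply: contraT => nj; exfalso.
have ne a b : a \in T -> b \notin T -> a != b by move=> aT; apply: contraNneq => <-.
have fresh a : a \in T -> (a != p) && (a != q) && (a != r) by move=> aT; rewrite !ne.
have [pW qW rW] : [/\ p \in W, q \in W & r \in W].
  by split; apply: sW; rewrite !inE eqxx ?orbT.
have TW a : a \in T -> a \in W by move=> aT; apply: sW; rewrite !inE aT !orbT.
have memW (ws : seq V) : all (mem W) ws -> {subset ws <= W} by move=> /allP.
have := fresh x xT; have := fresh y yT; have := fresh z zT; have := fresh w wT.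
move=> fw fz fy fx; split_uniq un.
have share x1 y1 z1 : x1 \in T -> y1 \in T -> z1 \in T -> x1 != y1 -> x1 != z1 -> y1 != z1 ->
    unjoined 2 [:: u; b1; p; q; r] x1 y1 -> unjoined 2 [:: b2; g; p; q; r] x1 z1 -> False.
  move=> xT1 yT1 zT1 ? ? ? N1 N2.
  have := fresh x1 xT1; have := fresh y1 yT1; have := fresh z1 zT1 => fz1 fy1 fx1.
  apply: (double_share tg (x := x1) (y := y1) (z := z1)) N1 N2.
  - repeat match goal with K : is_true (_ && _) |- _ => case/andP: K => ? ? end; distinct.
  - by apply: memW; rewrite /= (TW x1) // (TW y1) // (TW z1) // pW qW rW.
have same x1 y1 : x1 \in T -> y1 \in T -> x1 != y1 ->
    unjoined 2 [:: u; b1; p; q; r] x1 y1 -> unjoined 2 [:: b2; g; p; q; r] x1 y1 -> False.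
  move=> xT1 yT1 ? N1 N2.
  have := fresh x1 xT1; have := fresh y1 yT1 => fy1 fx1.
  apply: (double_same tg (x := x1) (y := y1)) N1 N2.
  - repeat match goal with K : is_true (_ && _) |- _ => case/andP: K => ? ? end; distinct.
  - by apply: memW; rewrite /= (TW x1) // (TW y1) // pW qW rW.
have njs : unjoined 2 [:: b2; g; p; q; r] w z by rewrite unjoined_sym.
have Nyx : unjoined 2 [:: u; b1; p; q; r] y x by rewrite unjoined_sym.
have [xz|xz] := eqVneq x z.
  subst z; have [yw|yw] := eqVneq y w; first by subst w; apply: (same x y).
  by apply: (share x y w).
have [xw|xw] := eqVneq x w.
  subst w; have [yz|yz] := eqVneq y z; first by subst z; apply: (same x y).
  by apply: (share x y z).
have [yz|yz] := eqVneq y z.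
  by subst z; apply: (share y x w) => //; rewrite eq_sym.
have [yw|yw] := eqVneq y w.
  by subst w; apply: (share y x z) => //; rewrite eq_sym.
apply: (double_apart tg (x := x) (y := y) (z := z) (w := w)) Nxy nj.
- repeat match goal with K : is_true (_ && _) |- _ => case/andP: K => ? ? end; distinct.
- by apply: memW; rewrite /= (TW x) // (TW y) // (TW z) // (TW w) // pW qW rW.
Qed.

(** Dropping [3 * k - 3] vertices leaves the last three of the segment, among which the missed
    vertex [e] must lie to serve as the next entry. *)
Lemma segment_middle k u (s : seq V) g W :
  0 < k <= 2 -> size s = (3 * k).-1 -> tight c k.+1 u s g W ->
  exists e A, [/\ e \in drop (3 * k - 3) (rcons s g), size A <= 2
                & joins_outside k (rem e (u :: rcons s g)) W A].
Proof.
case: k => [|[|[|k]]] // _ sz tg; last exact: block_middle tg.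
by case: s sz tg => [|b1 [|b2 [|? ?]]] // _ tg; apply: single_middle tg.
Qed.

Lemma segment_closing k u (s : seq V) g W x y p q :
  0 < k <= 2 -> size s = (3 * k).-1 -> tight c k.+1 u s g W ->
  (forall b, avoidable (unjoined k (rcons s g)) W [:: b]) ->
  uniq [:: x; y; p; q] -> {subset [:: x; y; p; q] <= W} ->
  joined c false k (u :: s ++ [:: p; q]) x y.
Proof.
case: k => [|[|[|k]]] // _ sz tg not_star un sW; last exact: (block_closing sz tg).
case: s sz tg not_star => [|b1 [|b2 [|? ?]]] // _ tg not_star.
apply: (@joined_sub _ _ _ _ [:: u; b1; b2]).
  by move=> i; rewrite !inE => /or3P[]->; rewrite ?orbT.
apply: single_closing tg not_star _ _ _; rewrite ?sW ?inE ?eqxx ?orbT //.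
by split_uniq un.
Qed.

End Segments.

(** * Chaining the segments *)

Section Chains.
Variables (V : finType) (c : {set V} -> bool).
Implicit Types (u g x y z : V) (s t p q P W T A : seq V) (ss : seq (seq V)).

(** A red path from [u] to [g] with one edge more than the segment could replace it and give a red
    cycle with [r + 1] edges. The entry [u] may be any of the last three vertices of [rest]. *)
Lemma cycle_tight k s g rest u W r :
  0 < k -> size s = (3 * k).-1 -> ~~ has_lcycle c true r.+1 ->
  size (rcons s g ++ rest) = 3 * r -> lcycle c true (rcons s g ++ rest) ->
  uniq (rcons s g ++ rest ++ W) -> 3 <= size rest -> u \in drop (size rest - 3) rest ->
  tight c k.+1 u s g W.
Proof.
move=> k_gt0 size_s no_cyc; rewrite size_cat size_rcons size_s.
have -> : (3 * k).-1.+1 = 3 * k by arith.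
move=> size_p cyc un rest3 u_rest.
have size_d : size (drop (size rest - 3) rest) = 3 by rewrite size_drop; arith.
have mem_rest z : z \in drop (size rest - 3) rest -> z \in rest by apply: mem_drop.
apply/andP; split.
  move: un; rewrite catA cat_uniq => /and3P[+ dis uW]; rewrite cat_uniq => /and3P[us dis' ur].
  rewrite -cat_rcons -cat_cons cat_uniq /= uW andbT us andbT; apply/andP; split.
    by move/hasPn: dis' => /(_ u (mem_rest _ u_rest)).
  apply/hasPn => z zW; move/hasPn: dis => /(_ z zW); rewrite /= mem_cat inE negb_or => /andP[zs zr].
  by rewrite negb_or zs andbT; apply: contraNneq zr => ->; apply: mem_rest.
apply: contra no_cyc => /joinedP[q [size_q uq qP pq]]; apply/has_lcycleP.
case E: (drop (size rest - 3) rest) u_rest size_d => [|a1 [|a2 [|a3 [|? ?]]]] // u_rest _.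
have [x1 [x2 pm]] : exists x1 x2, perm_eq [:: a1; a2; a3] [:: x1; x2; u].
  move: (rem u _) (perm_to_rem u_rest) => xs pu; have [] := perm_size pu.
  case: xs pu => [|x1 [|x2 [|? ?]]] // pu _; exists x1, x2.
  by rewrite (perm_trans pu) // -(perm_rcons u).
have rest_pm : perm_eq rest (take (size rest - 3) rest ++ [:: x1; x2; u]).
  by rewrite -{1}(cat_take_drop (size rest - 3) rest) E perm_cat2l.
(* The last edge is listed anew so that [u] becomes its final vertex, hence the hinge; as a set it
   is unchanged. *)
exists (rcons q g ++ take (size rest - 3) rest ++ [:: x1; x2; u]).
have dvd_t : 3 %| size (take (size rest - 3) rest).
  rewrite size_takel ?leq_subr //.
  by have -> : size rest - 3 = 3 * (r - k - 1); [arith | apply: dvdn_mulr].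
split.
- have size_rest : size rest = size (take (size rest - 3) rest ++ [:: x1; x2; u]).
    exact: perm_size.
  by rewrite size_cat -size_rest size_rcons size_q; arith.
- have : uniq (rcons q g ++ rest).
    rewrite cat_uniq rcons_uniq uq andbT.
    move: un; rewrite cat_uniq cat_uniq rcons_uniq.
    move=> /and3P[/andP[gs us] /hasPn dis /and3P[ur /hasPn disW uW]].
    rewrite ur andbT; apply/andP; split.
      apply/negP=> /qP; rewrite mem_cat (negbTE gs) /= => gW.
      by have := dis g; rewrite mem_cat gW orbT mem_rcons inE eqxx => /(_ isT).
    apply/hasPn => z zr /=; rewrite mem_rcons inE negb_or.
    have zs := dis z; rewrite mem_cat zr in zs; have := zs isT.
    rewrite /= mem_rcons inE negb_or => /andP[-> zs'] /=; apply/negP=> /qP.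
    by rewrite mem_cat (negbTE zs') /= => /disW; rewrite /= zr.
  by rewrite !cat_uniq (perm_uniq rest_pm) (perm_has _ rest_pm) !cat_uniq.
have dvd_q : 3 %| size (rcons q g) by rewrite size_rcons size_q; arith.
rewrite (lcycleE _ _ u) lpath_cat // !last_cat last_rcons /= pq lpath_cat //=.
move: cyc; rewrite (lcycleE _ _ u) lpath_cat; last by rewrite size_rcons size_s; arith.
rewrite last_cat !last_rcons => /andP[_].
have -> : lpath c true g rest = lpath c true g (take (size rest - 3) rest ++ [:: a1; a2; a3]).
  by rewrite -E cat_take_drop.
set y := last g _; have -> : [set z in [:: y; x1; x2; u]] = [set z in [:: y; a1; a2; a3]].
  by apply: eq_set_seq => z; rewrite inE [RHS]inE (perm_mem pm).
by rewrite lpath_cat //= andbT.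
Qed.

(** On a length divisible by 3, all pieces are segments of two edges, except a last one of one edge
    when the number of edges is odd. *)
Fixpoint cut p : seq (seq V) :=
  match p with
  | [:: v1, v2, v3, v4, v5, v6 & p'] => [:: v1; v2; v3; v4; v5; v6] :: cut p'
  | [::] => [::]
  | _ => [:: p]
  end.

Definition is_segment t : bool := (size t == 3) || (size t == 6).

Lemma cutP p : 3 %| size p ->
  [/\ flatten (cut p) = p, all is_segment (cut p) & size (cut p) = (size p + 3) %/ 6].
Proof.
have [n] := ubnP (size p); elim: n p => // n IHn.
case=> [|v1 [|v2 [|v3 [|v4 [|v5 [|v6 p]]]]]] //= pn dvd_p.
have dvd_p' : 3 %| size p by move: dvd_p; rewrite -[_.+4]/(6 + size p) dvdn_addr.
have [|fl al sz] := IHn p _ dvd_p'; first by arith.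
by rewrite fl al sz; split=> //; arith.
Qed.

(* [(k, P, A)]: the pool [P] joins any two vertices of [W] outside [A] by a blue
   path with [k] edges. *)
Notation link := (nat * seq V * seq V)%type.
Implicit Types (l : link) (ls : seq link).

Definition link_ok W l : Prop :=
  [/\ 0 < l.1.1, size l.2 <= 2 & joins_outside c l.1.1 l.1.2 W l.2].

Definition pools ls : seq V := flatten [seq l.1.2 | l <- ls].
Definition edges ls : nat := sumn [seq l.1.1 | l <- ls].

Lemma segment_split t : is_segment t ->
  exists k s g, [/\ t = rcons s g, 0 < k <= 2, size s = (3 * k).-1 & size t = 3 * k].
Proof.
case/lastP: t => // s g; rewrite /is_segment size_rcons.
by case/orP=> /eqP E; [exists 1|exists 2]; exists s, g; rewrite E; split=> //; arith.
Qed.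

(** Induction along the cycle: [pre] is the part already passed and [u] the current entry. A segment
    [t] contributes the pool [rem e (u :: t)], and the missed vertex [e] is the entry of the next
    segment; [u'] is the entry left over at the end. *)
Lemma chain W r ss pre u :
  ~~ has_lcycle c true r.+1 -> size (pre ++ flatten ss) = 3 * r ->
  lcycle c true (pre ++ flatten ss) -> uniq (pre ++ flatten ss ++ W) ->
  all is_segment ss -> 3 %| size pre -> 3 <= size pre -> u \in drop (size pre - 3) pre ->
  exists ls u', [/\ size ls = size ss, 3 * edges ls = size (flatten ss),
    (forall l, l \in ls -> link_ok W l), uniq (u' :: pools ls)
    & {subset u' :: pools ls <= u :: flatten ss} /\
      u' \in drop (size (pre ++ flatten ss) - 3) (pre ++ flatten ss)].
Proof.
move=> no_cyc; elim: ss pre u => [|t ss IHss] pre u.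
  by rewrite /= cats0 => _ _ _ _ _ _ u_pre; exists [::], u; do 2?split.
move=> size_p cyc un /= /andP[t_seg ss_seg] dvd_pre pre3 u_pre.
have [k [s [g [tE k12 size_s size_t]]]] := segment_split t_seg.
have dvd_t : 3 %| size t by rewrite size_t; arith.
have dvd_ss : 3 %| size (flatten ss).
  by move: size_p dvd_pre dvd_t; rewrite /= !size_cat; arith.
have tg : tight c k.+1 u s g W.
  (* The cycle is rotated to start with [t]; it then ends with [pre], whose last three vertices
     contain [u]. *)
  apply: (@cycle_tight k s g (flatten ss ++ pre) u W r) => //; rewrite -?tE.
  - arith.
  - by move: size_p; rewrite /= !size_cat; arith.
  - by rewrite catA (lcycle_rot c true _ dvd_pre) // size_cat dvdn_addr.
  - rewrite -(perm_uniq (s1 := pre ++ flatten (t :: ss) ++ W)) //.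
    by apply/permP => a; rewrite /= !count_cat; arith.
  - by rewrite size_cat; arith.
  - rewrite size_cat drop_cat; have -> : size (flatten ss) + size pre - 3 < size (flatten ss) = false by arith.
    by have -> : size (flatten ss) + size pre - 3 - size (flatten ss) = size pre - 3 by arith.
have [e [A [e_t A2 joins]]] := segment_middle k12 size_s tg.
rewrite -tE -size_t in e_t joins.
have e_pret : e \in drop (size (pre ++ t) - 3) (pre ++ t).
  rewrite size_cat drop_cat; have -> : size pre + size t - 3 < size pre = false by arith.
  by have -> : size pre + size t - 3 - size pre = size t - 3 by arith.
have [|||||||ls [u' [size_ls sum_ls ok_ls un_ls [sub_ls u'_end]]]] := IHss (pre ++ t) e.
- by rewrite -catA.
- by rewrite -catA.
- by move: un; rewrite /= -!catA.
- by [].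
- by rewrite size_cat dvdn_addr.
- by rewrite size_cat; arith.
- exact: e_pret.
have un_ut : uniq (u :: t).
  by move: tg => /andP[+ _]; rewrite -cat_rcons -tE -cat_cons cat_uniq => /and3P[].
have et : e \in t by apply: mem_drop e_t.
have u_pre' : u \in pre by apply: mem_drop u_pre.
have sub_ss z : z \in flatten ss -> z \notin u :: t.
  move=> z_ss; move: un; rewrite /= !cat_uniq.
  move=> /and3P[_ /hasPn dis /and3P[/and3P[_ /hasPn dis' _] _ _]].
  rewrite inE negb_or [_ \notin t]dis' // andbT.
  by apply: contraTneq u_pre' => <-; apply: dis; rewrite !mem_cat z_ss orbT.
have sub_e z : z \in e :: flatten ss -> z \notin rem e (u :: t).
  rewrite inE mem_rem_uniq // inE => /orP[/eqP->|/sub_ss]; first by rewrite eqxx.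
  by move=> /negbTE->; rewrite andbF.
have u'_new : u' \notin rem e (u :: t) by apply/sub_e/sub_ls/mem_head.
have uP : uniq (rem e (u :: t)) by apply: rem_uniq.
have subP z : z \in rem e (u :: t) -> z \in u :: t by apply: mem_rem.
move: (rem e (u :: t)) joins sub_e u'_new uP subP => P joins sub_e u'_new uP subP.
exists ((k, P, A) :: ls), u'; split.
- by rewrite /= size_ls.
- by rewrite /edges /= size_cat mulnDr sum_ls size_t.
- by move=> l; rewrite inE => /orP[/eqP->|/ok_ls//]; split=> //=; arith.
- move: un_ls; rewrite /pools /= mem_cat negb_or u'_new cat_uniq uP /= => /andP[-> ->].
  rewrite andbT; apply/hasPn => z z_ls; apply/sub_e/sub_ls.
  by rewrite inE z_ls orbT.
split; last by move: u'_end; rewrite /= -catA.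
move=> z; rewrite /pools /= inE mem_cat inE mem_cat.
have up v : v \in e :: flatten ss -> (v \in t) || (v \in flatten ss).
  by rewrite inE => /orP[/eqP->|->]; rewrite ?et ?orbT.
case/or3P=> [/eqP->|/subP|z_ls].
- by rewrite up ?orbT // sub_ls ?mem_head.
- by rewrite inE => /orP[->|->]; rewrite ?orbT.
by rewrite up ?orbT // sub_ls // inE z_ls orbT.
Qed.

Fixpoint linked x ls (ys : seq V) : bool :=
  match ls, ys with
  | l :: ls', y :: ys' =>
      [&& 0 < l.1.1, joined c false l.1.1 l.1.2 x y & linked y ls' ys']
  | [::], [::] => true
  | _, _ => false
  end.

Lemma linked_rcons x ls (ys : seq V) l y :
  linked x ls ys -> 0 < l.1.1 -> joined c false l.1.1 l.1.2 (last x ys) y ->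
  linked x (rcons ls l) (rcons ys y).
Proof.
elim: ls x ys => [|l' ls IHls] x [|y' ys] //=; first by move=> _ -> ->.
by move=> /and3P[-> -> lk] l_gt0 jy; apply: IHls.
Qed.

Lemma glue x ls (ys : seq V) :
  linked x ls ys -> uniq (pools ls ++ ys) ->
  exists q, [/\ size q = 3 * edges ls, uniq q, {subset q <= pools ls ++ ys},
    lpath c false x q & last x q = last x ys].
Proof.
elim: ls x ys => [|l ls IHls] x [|y ys] //=; first by exists [::].
case/and3P=> l_gt0 /joinedP[q1 [size_q1 uq1 q1_l pq1]] lk.
rewrite /pools /= -/(pools ls) => un.
have un' : uniq (y :: l.1.2 ++ pools ls ++ ys).
  rewrite -(perm_uniq (s1 := (l.1.2 ++ pools ls) ++ y :: ys)) //.
  by apply/permP => a; rewrite /= !count_cat /=; arith.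
have [y_new /=] : y \notin l.1.2 ++ pools ls ++ ys /\ uniq (l.1.2 ++ pools ls ++ ys).
  by case/andP: un'.
rewrite cat_uniq => /and3P[_ /hasPn dis uls].
have [q [size_q uq q_ls pq last_q]] := IHls y ys lk uls.
have size_q1y : size (rcons q1 y) = 3 * l.1.1 by rewrite size_rcons size_q1; arith.
exists (rcons q1 y ++ q); split.
- by rewrite size_cat size_q1y size_q /edges /= mulnDr.
- rewrite cat_uniq rcons_uniq uq1 uq !andbT; apply/andP; split.
    by apply: contra y_new => /q1_l; rewrite mem_cat => ->.
  apply/hasPn => z /q_ls z_ls; rewrite /= mem_rcons inE negb_or; apply/andP; split.
    by apply: contraNneq y_new => <-; rewrite mem_cat z_ls orbT.
  by apply/negP=> /q1_l zl; have := dis _ z_ls; rewrite /= zl.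
- move=> z; rewrite mem_cat mem_rcons inE -orbA => /or3P[/eqP->|/q1_l zl|/q_ls].
  + by rewrite !(mem_cat, inE) eqxx !orbT.
  + by rewrite !mem_cat zl.
  by rewrite !(mem_cat, inE) => /orP[]->; rewrite !orbT.
- by rewrite lpath_cat ?size_q1y ?dvdn_mulr // pq1 last_rcons.
by rewrite last_cat last_rcons.
Qed.

Lemma fresh_vertex T A : uniq T -> size A < size T -> exists2 y, y \in T & y \notin A.
Proof.
move=> uT lt_AT; apply/hasP; apply: contraLR lt_AT => /hasPn sub; rewrite -leqNgt.
by apply: uniq_leq_size => // z zT; have := sub z zT; rewrite negbK.
Qed.

(** Greedy choice. A hinge between two links avoids at most four exceptional vertices, the last
    hinge at most three, and one vertex of [T] is used per link. The initial hinge [x] is left open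
    because it also has to suit the closing link. *)
Lemma choose_hinges W ls (fin : seq V) T :
  (forall l, l \in ls -> link_ok W l) -> size fin <= 1 -> uniq T -> {subset T <= W} ->
  0 < size ls -> size ls + 3 <= size T ->
  exists ys, [/\ size ys = size ls, uniq ys, {subset ys <= T}, forall x, last x ys \notin fin
    & forall x, x \in W -> x \notin (head (0, [::], [::]) ls).2 -> x \notin ys -> linked x ls ys].
Proof.
elim: ls T => // l ls IHls T ok_ls fin1 uT subT _ size_T.
have [l_gt0 l_avoid l_joins] := ok_ls l (mem_head _ _).
case: ls IHls ok_ls size_T => [|l' ls] IHls ok_ls size_T.
  have [|y yT] := fresh_vertex (A := l.2 ++ fin) uT; first by rewrite size_cat /= in size_T *; arith.
  rewrite mem_cat negb_or => /andP[yl y_fin]; exists [:: y]; split=> //.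
    by move=> z; rewrite inE => /eqP->.
  move=> x xW xl; rewrite inE => xy /=; rewrite l_gt0 andbT /=.
  by apply: l_joins => //; apply: subT.
have [l'_gt0 l'_avoid _] : link_ok W l' by apply: ok_ls; rewrite !inE eqxx orbT.
have [|y yT] := fresh_vertex (A := l.2 ++ l'.2) uT; first by rewrite size_cat /= in size_T *; arith.
rewrite mem_cat negb_or => /andP[yl yl'].
have size_rem : size (rem y T) = (size T).-1 by apply: size_rem.
have [||||||ys [size_ys uys sub_ys last_ys lk_ys]] := IHls (rem y T) => //.
- by move=> l2 l2_in; apply: ok_ls; rewrite inE l2_in orbT.
- exact: rem_uniq.
- by move=> z /mem_rem/subT.
- by rewrite size_rem; move: size_T => /=; arith.
have y_new : y \notin ys.
  by apply/negP=> /sub_ys; rewrite mem_rem_uniq // inE eqxx.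
exists (y :: ys); split=> //.
- by rewrite /= size_ys.
- by rewrite /= y_new.
- by move=> z; rewrite inE => /orP[/eqP->//|/sub_ys/mem_rem].
- by move=> x; apply: last_ys.
move=> x xW xl; rewrite inE negb_or => /andP[xy xys].
have yW := subT _ yT; rewrite [linked _ _ _]/= l_gt0 (l_joins x y) //=.
exact: lk_ys.
Qed.

Lemma close_cycle W ls k (fin : seq V) T :
  (forall l, l \in ls -> link_ok W l) -> size fin <= 1 -> uniq T -> {subset T <= W} ->
  0 < size ls -> size ls + 3 <= size T -> 0 < k ->
  size (head (0, [::], [::]) ls).2 + size fin <= 2 ->
  (forall x ys, size ys = size ls -> uniq (x :: ys) -> {subset x :: ys <= T} ->
     x \notin fin -> last x ys \notin fin ->
     exists2 P, joined c false k P (last x ys) x & uniq (pools ls ++ P ++ x :: ys)) ->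
  has_lcycle c false (edges ls + k).
Proof.
move=> ok_ls fin1 uT subT ls_gt0 size_T k_gt0 size_h close.
have [ys [size_ys uys sub_ys last_ys lk_ys]] := choose_hinges ok_ls fin1 uT subT ls_gt0 size_T.
have [|x xT] := fresh_vertex (A := (head (0, [::], [::]) ls).2 ++ fin ++ ys) uT.
  by rewrite !size_cat size_ys; arith.
rewrite !mem_cat !negb_or => /and3P[xh xfin xys].
have [||P jP un] := close x ys size_ys _ _ xfin (last_ys x).
- by rewrite /= xys.
- by move=> z; rewrite inE => /orP[/eqP->|/sub_ys].
have lk := lk_ys x (subT _ xT) xh xys.
have [||q [size_q uq _ pq last_q]] := glue (x := x) (ls := rcons ls (k, P, [::])) (ys := rcons ys x).
- exact: linked_rcons.
- rewrite -(perm_uniq (s1 := pools ls ++ P ++ x :: ys)) //.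
  apply/permP => a; rewrite /pools map_rcons flatten_rcons !count_cat /=.
  by rewrite -cats1 count_cat /=; arith.
apply/has_lcycleP; exists q; split=> //.
  by rewrite size_q /edges map_rcons sumn_rcons.
by rewrite (lcycleE _ _ x) last_q last_rcons.
Qed.

End Chains.

Section Extension.
Variables (V : finType) (c : {set V} -> bool).
Implicit Types (u g x y z : V) (s t p q P W T A : seq V) (ss : seq (seq V)).

Lemma outer_vertices p : uniq p -> exists W, uniq (p ++ W) /\ size W = #|V| - size p.
Proof.
move=> up; exists [seq x <- enum V | x \notin p].
have un : uniq (p ++ [seq x <- enum V | x \notin p]).
  rewrite cat_uniq up filter_uniq ?enum_uniq // andbT /=.
  by apply/hasPn => x; rewrite mem_filter => /andP[].
split=> //; apply/esym/eqP; rewrite -(eqn_add2l (size p)) subnKC ?max_card //; last first.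
  by rewrite -(card_uniqP up) max_card.
rewrite -size_cat cardE; apply/eqP/perm_size/uniq_perm; rewrite ?enum_uniq // => x.
by rewrite mem_cat mem_filter mem_enum andbT inE; case: (x \in p).
Qed.

Lemma star_or k P W :
  (exists b, joins_outside c k P W [:: b]) \/
  (forall b, avoidable (unjoined c k P) W [:: b]).
Proof.
pose bad b x y := [&& x \in W, y \in W, x != y, unjoined c k P x y & (x != b) && (y != b)].
have [/existsP[b /forallP star]|no_star] :=
  boolP [exists b, forall x, forall y, ~~ bad b x y].
  left; exists b => x y xW yW xy; rewrite !inE => xb yb; apply: contraT => nj.
  by move: (forallP (star x) y); rewrite /bad /unjoined xW yW xy nj xb yb.
right=> b; move/existsPn: no_star => /(_ b)/forallPn[x /forallPn[y]].
rewrite negbK => /and5P[xW yW xy Nxy xyb]; exists x, y; split=> //.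
by rewrite !inE.
Qed.

Lemma all_or_ex ss (Q R : seq V -> Prop) :
  (forall t, Q t \/ R t) -> (forall t, t \in ss -> Q t) \/ (exists2 t : seq V, t \in ss & R t).
Proof.
move=> QR; elim: ss => [|t ss [IHss|[t' t'ss Rt']]]; first by left.
  case: (QR t) => [Qt|Rt]; last by right; exists t; rewrite ?mem_head.
  by left=> t'; rewrite inE => /orP[/eqP->|/IHss].
by right; exists t'; rewrite ?inE ?t'ss ?orbT.
Qed.

(** A one-edge segment therefore forces an odd number of edges, which is needed when hinges are
    counted. *)
Lemma cut_even p t : 3 %| size p -> t \in cut p -> ~~ odd (size p) -> size t = 6.
Proof.
have [n] := ubnP (size p); elim: n p => // n IHn.
case=> [|v1 [|v2 [|v3 [|v4 [|v5 [|v6 p]]]]]] //= pn dvd_p.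
rewrite inE !negbK => /orP[/eqP->//|t_p] even_p.
have dvd_p' : 3 %| size p by move: dvd_p; rewrite -[_.+4]/(6 + size p) dvdn_addr.
by apply: (IHn p) => //; arith.
Qed.

Lemma star_links W ss :
  all (@is_segment V) ss ->
  (forall t, t \in ss -> exists b, joins_outside c (size t %/ 3) t W [:: b]) ->
  exists ls, [/\ [seq l.1.2 | l <- ls] = ss, 3 * edges ls = size (flatten ss)
    & forall l, l \in ls -> link_ok c W l /\ size l.2 = 1].
Proof.
elim: ss => [|t ss IHss] /=; first by exists [::].
move=> /andP[t_seg ss_seg] stars.
have [t' t'_ss|ls [ls_ss sum_ls ok_ls]] := IHss ss_seg; first by apply: stars; rewrite inE t'_ss orbT.
have [b star] := stars t (mem_head _ _).
exists ((size t %/ 3, t, [:: b]) :: ls); split=> /=.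
- by rewrite ls_ss.
- rewrite size_cat mulnDr sum_ls; congr (_ + _).
  by move: t_seg => /orP[]/eqP->.
move=> l; rewrite inE => /orP[/eqP->|/ok_ls//]; split=> //; split=> //=.
by move: t_seg => /orP[]/eqP->.
Qed.

Lemma last_tail x p n : 0 < size p -> 0 < n -> last x p \in drop (size p - n) p.
Proof.
case/lastP: p => // p y _ n_gt0; rewrite last_rcons size_rcons drop_rcons; last by arith.
by rewrite mem_rcons mem_head.
Qed.

(** * A longer red cycle or a blue cycle *)

Lemma cycle_extension r m :
  3 <= m <= r -> 3 * r.+1 + (m - 1) %/ 2 <= #|V| ->
  has_lcycle c true r -> has_lcycle c true r.+1 || has_lcycle c false m.
Proof.
move=> /andP[m3 mr] card_V /has_lcycleP[p [size_p up cyc]].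
case: (boolP (has_lcycle c true r.+1)) => //= no_cyc.
have [W [un size_W]] := outer_vertices up.
have W_big : 3 + (m - 1) %/ 2 <= size W by rewrite size_W size_p; arith.
have uW : uniq W by move: un; rewrite cat_uniq => /and3P[].
have size_tk : size (take (3 * m) p) = 3 * m by rewrite size_takel // size_p; arith.
have [fl_ss seg_ss size_ss] : [/\ flatten (cut (take (3 * m) p)) = take (3 * m) p,
    all (@is_segment V) (cut (take (3 * m) p))
    & size (cut (take (3 * m) p)) = (3 * m + 3) %/ 6].
  by have := cutP (p := take (3 * m) p); rewrite size_tk dvdn_mulr // => /(_ isT).
have [|stars|[t t_ss no_star]] := @all_or_ex (cut (take (3 * m) p))
    (fun t => exists b, joins_outside c (size t %/ 3) t W [:: b])
    (fun t => forall b, avoidable (unjoined c (size t %/ 3) t) W [:: b]).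
- by move=> t; apply: star_or.
(* Here the pools are the segments themselves, each with one exceptional vertex, and the last link
   closes the cycle. *)
- have [ls [ls_ss sum_ls ok_ls]] := star_links seg_ss stars.
  have size_ls : size ls = (3 * m + 3) %/ 6 by rewrite -size_ss -ls_ss size_map.
  have m_ls : edges ls = m by move: sum_ls; rewrite fl_ss size_tk; arith.
  have un_ls : uniq (pools ls ++ W).
    rewrite /pools ls_ss fl_ss; apply: subseq_uniq un; apply: cat_subseq => //.
    exact: take_subseq.
  case/lastP: ls ls_ss sum_ls ok_ls size_ls m_ls un_ls => [|ls l]; first by move=> _ _ _ /=; arith.
  move=> _ _ ok_ls; rewrite size_rcons => size_ls m_ls un_ls.
  have [[l_gt0 l_2 l_joins] l_1] : link_ok c W l /\ size l.2 = 1.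
    by apply: ok_ls; rewrite mem_rcons mem_head.
  have ok_ls' l' : l' \in ls -> link_ok c W l' /\ size l'.2 = 1.
    by move=> l'_ls; apply: ok_ls; rewrite mem_rcons inE l'_ls orbT.
  have <- : edges ls + l.1.1 = m by rewrite -m_ls /edges map_rcons sumn_rcons.
  apply: (@close_cycle _ _ W ls _ l.2 W) => //.
  + by move=> l' /ok_ls'[].
  + by rewrite l_1.
  + arith.
  + arith.
  + case: (ls) ok_ls' => [|l' ls'] ok_ls' /=; rewrite l_1 //.
    by have [_ ->] := ok_ls' l' (mem_head _ _).
  move=> x ys size_ys uxys sub_xys x_l last_l; exists l.1.2.
    apply: l_joins => //; first by apply: sub_xys; apply: mem_last.
      by apply: sub_xys; apply: mem_head.
    case: (ys) size_ys uxys => [|y ys'] /=; first arith.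
    by move=> _ /andP[x_ys _]; apply: contraNneq x_ys => <-; apply: mem_last.
  move: un_ls; rewrite catA /pools map_rcons flatten_rcons; move: (flatten _ ++ _) => S.
  rewrite !cat_uniq uxys andbT => /and3P[-> /hasPn dis _].
  by apply/hasPn => z /sub_xys; apply: dis.
have t_seg := allP seg_ss t t_ss.
have [k [s [g [tE k12 size_s size_t]]]] := segment_split t_seg.
rewrite size_t mulKn // in no_star.
have k1_odd : k = 1 -> odd m.
  move=> k1; rewrite k1 in size_t; apply: contraLR isT => even_m.
  suff : size t = 6 by rewrite size_t.
  by apply: (cut_even _ t_ss); rewrite size_tk ?dvdn_mulr // oddM.
(* The cycle is rotated so that the exceptional segment [t] comes first. *)
have [rest [size_rest cyc' un']] : exists rest, [/\ size rest = 3 * (r - k),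
    lcycle c true (t ++ rest) & uniq (t ++ rest ++ W)].
  have [s1 [s2 ssE]] : exists s1 s2 : seq (seq V), cut (take (3 * m) p) = s1 ++ t :: s2.
    by case/splitPr: t_ss => s1 s2; exists s1, s2.
  rewrite ssE in fl_ss seg_ss.
  have dvd_fl ss : all (@is_segment V) ss -> 3 %| size (flatten ss).
    elim: ss => //= t' ss IHss /andP[t'_seg /IHss dvd_ss].
    by rewrite size_cat dvdn_addr //; case/orP: t'_seg => /eqP->.
  move: seg_ss; rewrite all_cat /= => /and3P[/dvd_fl dvd1 _ /dvd_fl dvd2].
  have pE : p = flatten s1 ++ t ++ flatten s2 ++ drop (3 * m) p.
    by rewrite -{1}(cat_take_drop (3 * m) p) -fl_ss flatten_cat /= -!catA.
  exists ((flatten s2 ++ drop (3 * m) p) ++ flatten s1).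
  have size_pE : size p = size (flatten s1) + (3 * k + (size (flatten s2) + size (drop (3 * m) p))).
    by rewrite {1}pE !size_cat size_t.
  split.
  - by rewrite !size_cat; arith.
  - rewrite catA lcycle_rot // -?pE //; rewrite !size_cat; arith.
  rewrite -(perm_uniq (s1 := p ++ W)) // {1}pE.
  by apply/permP => a; rewrite !count_cat; arith.
have [k_gt0 k2] : 0 < k /\ k <= 2 by arith.
(* Skipping [r - m] edges after [t] leaves [m - k] edges for the chain, which ends just before [t];
   its last entry [u'] is thus an entry of [t]. *)
set n := size rest - 3 * (m - k).
have size_rest2 : size (drop n rest) = 3 * (m - k) by rewrite size_drop /n size_rest; arith.
have size_skip : size (take n rest) = n by rewrite size_takel // leq_subr.
have n3 : n = 3 * (r - m) by rewrite /n size_rest; arith.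
have [|fl2 seg2 size2] := cutP (p := drop n rest); first by rewrite size_rest2 dvdn_mulr.
rewrite size_rest2 in size2.
have split_rest : (t ++ take n rest) ++ drop n rest = t ++ rest by rewrite -catA cat_take_drop.
set pre := t ++ take n rest in split_rest.
have size_pre : size pre = 3 * k + n by rewrite size_cat size_t size_skip.
have pre_gt0 : 0 < size pre by arith.
have size_all : size (t ++ rest) = 3 * r by rewrite size_cat size_t size_rest; arith.
have [|||||||ls [u' [size_ls sum_ls ok_ls un_ls [sub_ls u'_end]]]] :=
  @chain V c W r (cut (drop n rest)) pre (last g pre) no_cyc.
- by rewrite fl2 split_rest.
- by rewrite fl2 split_rest.
- by rewrite fl2 catA split_rest -catA.
- exact: seg2.
- by rewrite size_pre n3 dvdn_addr ?dvdn_mulr.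
- by arith.
- by apply: last_tail.
rewrite fl2 split_rest size_all in u'_end; rewrite fl2 in sub_ls.
have u'_rest : u' \in drop (size rest - 3) rest.
  move: u'_end; rewrite drop_cat size_t; have -> : 3 * r - 3 < 3 * k = false by arith.
  by have -> : 3 * r - 3 - 3 * k = size rest - 3 by rewrite size_rest; arith.
have tg : tight c k.+1 u' s g W.
  by apply: (@cycle_tight V c k s g rest u' W r) => //; rewrite -?tE //; arith.
have m_ls : edges ls = m - k by move: sum_ls; rewrite fl2 size_rest2; arith.
(* The chain has [(m - k + 1) %/ 2] links. For [k = 1] this equals [(m - 1) %/ 2] only because [m]
   is odd. *)
have ls_W : size ls + 3 <= size W.
  rewrite size_ls size2; have [k1|->] : k = 1 \/ k = 2 by arith.
    have := k1_odd k1; rewrite k1 => m_odd; clear - m_odd W_big m3; lia.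
  by clear - W_big m3; lia.
have -> : m = edges ls + k by arith.
apply: (@close_cycle V c W ls k [::] W) => //.
- by rewrite size_ls size2; arith.
- case: (ls) ok_ls => [|l ls'] ok_ls //=; rewrite addn0.
  by have [] := ok_ls l (mem_head _ _).
move=> x ys size_ys uxys sub_xys _ _.
have size_xys : size (x :: ys) + 2 <= size W by rewrite /= size_ys; arith.
(* The hinges number one more than the links, so two spare vertices of [W] remain. *)
have [|z1 z1W z1xys] := fresh_vertex (T := W) (A := x :: ys) uW; first by arith.
have [|z2 z2W] := fresh_vertex (T := W) (A := z1 :: x :: ys) uW; first by rewrite /=; arith.
rewrite inE negb_or => /andP[z21 z2xys].
have z12 : z1 != z2 by rewrite eq_sym.
have last_xys : last x ys \in x :: ys by apply: mem_last.
have x_last : last x ys != x.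
  case: (ys) size_ys uxys => [|y ys'] /=; first by rewrite size_ls size2; arith.
  by move=> _ /andP[x_ys _]; apply: contraNneq x_ys => <-; apply: mem_last.
exists (u' :: s ++ [:: z1; z2]).
  apply: (segment_closing k12 size_s tg); first by rewrite -tE.
    have ne z v : z \notin x :: ys -> v \in x :: ys -> v != z.
      by move=> zn; apply: contraTneq => ->.
    have x_xys : x \in x :: ys by apply: mem_head.
    by rewrite /= !inE !negb_or x_last z12 !(ne z1, ne z2).
  by move=> z; rewrite !inE => /or4P[]/eqP-> //; apply: sub_xys; rewrite ?mem_head.
have un_hinges : uniq ([:: z1; z2] ++ x :: ys).
  by rewrite !cat_cons cat0s cons_uniq inE negb_or z12 z1xys cons_uniq z2xys uxys.
rewrite -(perm_uniq (s1 := (u' :: pools ls) ++ s ++ ([:: z1; z2] ++ x :: ys))); last first.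
  by apply/permP => a; rewrite /= !count_cat /= !count_cat /=; arith.
have sub_hinges z : z \in [:: z1; z2] ++ x :: ys -> z \in W.
  by rewrite mem_cat !inE -orbA => /or3P[/eqP->|/eqP->|] // z_xys; apply: sub_xys; rewrite inE.
(* The chain may start at [g], when no edge is skipped, but never touches the interior [s] of the
   closing segment. *)
have pools_rest z : z \in u' :: pools ls -> (z == g) || (z \in rest).
  move/sub_ls; rewrite inE => /orP[/eqP->|/mem_drop->]; last by rewrite orbT.
  have mt : {subset take n rest <= rest} by move=> v; apply: mem_take.
  rewrite /pre last_cat tE last_rcons; case: (take n rest) mt => [|y q] mt /=.
    by rewrite eqxx.
  by rewrite mt ?orbT // mem_last.
move: un'; rewrite tE catA cat_uniq => /and3P[+ /hasPn disW _].
rewrite cat_uniq rcons_uniq => /and3P[/andP[gs us] /hasPn dis _].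
move: (u' :: pools ls) (_ ++ x :: ys) un_ls pools_rest un_hinges sub_hinges.
move=> Q H uQ pools_rest uH sub_hinges; rewrite cat_uniq uQ cat_uniq us uH !andbT /=.
apply/andP; split.
  apply/hasPn => z; rewrite mem_cat => /orP[zs|/sub_hinges zW].
    apply/negP=> /pools_rest /orP[/eqP zg|z_rest]; first by rewrite -zg zs in gs.
    by have := dis z z_rest; rewrite /= mem_rcons inE zs orbT.
  apply/negP=> /pools_rest z_gr; have := disW z zW.
  by rewrite /= mem_cat mem_rcons inE -orbA orbCA z_gr orbT.
by apply/hasPn => z /sub_hinges/disW; rewrite /= mem_cat mem_rcons inE => /norP[/norP[_ ->]].
Qed.

End Extension.

(** * Monochromatic cycles with [m] edges *)

Section Diagonal.
Variable V : finType.
Implicit Types (c : {set V} -> bool) (u g x y z : V) (s t p q P W T A : seq V).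

(** The chain enters [rest] at [b1], which is one of the three vertices before it. So [b2] and [g]
    stay free, and with [v1, v2, v3] they carry two blue edges, giving [(m - 2) + 2] edges in
    all. *)
Lemma double_closing c m b1 b2 g rest W T v1 v2 v3 :
  3 <= m -> ~~ has_lcycle c true m -> size ([:: b1; b2; g] ++ rest) = 3 * m.-1 ->
  lcycle c true ([:: b1; b2; g] ++ rest) -> uniq ([:: b1; b2; g] ++ rest ++ W) ->
  uniq T -> {subset v1 :: v2 :: v3 :: T <= W} -> uniq (v1 :: v2 :: v3 :: T) ->
  joins_outside c 2 [:: b2; g; v1; v2; v3] T [::] -> (m - 1) %/ 2 + 3 <= size T ->
  has_lcycle c false m.
Proof.
move=> m3 no_cyc size_p cyc un uT subW uvT joins T_big.
have mE : m.-1.+1 = m by arith.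
have size_rest : size rest = 3 * (m - 2) by move: size_p; rewrite size_cat /=; arith.
have dvd_rest : 3 %| size rest by rewrite size_rest dvdn_mulr.
have [fl_ss seg_ss size_ss] := cutP dvd_rest.
have b1_pre : b1 \in drop (size [:: b1; b2; g] - 3) [:: b1; b2; g].
  by rewrite subnn drop0 mem_head.
have no_cyc' : ~~ has_lcycle c true m.-1.+1 by rewrite mE.
have := @chain V c W m.-1 (cut rest) [:: b1; b2; g] b1 no_cyc'; rewrite fl_ss.
move=> /(_ size_p cyc un seg_ss isT isT b1_pre).
move=> [ls [u' [size_ls sum_ls ok_ls un_ls [sub_ls _]]]].
rewrite size_ss size_rest in size_ls.
have -> : m = edges ls + 2 by arith.
have subT : {subset T <= W} by move=> z zT; apply: subW; rewrite !inE zT !orbT.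
apply: (@close_cycle V c W ls 2 [::] T) => //.
- by arith.
- by arith.
- by case: (ls) ok_ls => [|l ls'] ok_ls //=; rewrite addn0; have [] := ok_ls l (mem_head _ _).
move=> x ys size_ys uxys sub_xys _ _; exists [:: b2; g; v1; v2; v3].
  apply: joins => //; first by apply: sub_xys; apply: mem_last.
    by apply: sub_xys; apply: mem_head.
  case: (ys) size_ys uxys => [|y ys'] /=; first by rewrite size_ls; arith.
  by move=> _ /andP[x_ys _]; apply: contraNneq x_ys => <-; apply: mem_last.
have uH : uniq ([:: v1; v2; v3] ++ x :: ys).
  move: uvT; rewrite -[v1 :: v2 :: v3 :: T]/([:: v1; v2; v3] ++ T) !cat_uniq uxys andbT.
  by move=> /and3P[-> /hasPn dis _]; apply/hasPn => z /sub_xys/dis.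
have subH z : z \in [:: v1; v2; v3] ++ x :: ys -> z \in W.
  move=> zH; apply: subW; move: zH.
  by rewrite -[v1 :: v2 :: v3 :: T]/([:: v1; v2; v3] ++ T) !mem_cat => /orP[->|/sub_xys->] //; rewrite orbT.
rewrite -(perm_uniq (s1 := pools ls ++ [:: b2; g] ++ ([:: v1; v2; v3] ++ x :: ys))); last first.
  by apply/permP => a; rewrite /= !count_cat /=; arith.
move: (_ ++ x :: ys) uH subH => H uH subH.
have subQ z : z \in pools ls -> (z == b1) || (z \in rest).
  by move=> zQ; have := sub_ls z; rewrite !inE zQ orbT => /(_ isT).
move: (pools ls) un_ls subQ => Q /= /andP[_ uQ] subQ.
move: un; rewrite /= !inE !mem_cat !negb_or cat_uniq -!andbA.
case/and5P=> b12 b1g b1r b1W; case/and5P=> b2g b2r b2W gr; case/and4P=> gW _ /hasPn disW _.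
have inQ v : v != b1 -> v \notin rest -> v \notin Q.
  by move=> vb vr; apply/negP=> /subQ; rewrite (negbTE vb) (negbTE vr).
have inH v : v \notin W -> v \notin H by move=> vW; apply/negP=> /subH; rewrite (negbTE vW).
have b2Q : b2 \notin Q by rewrite inQ // eq_sym.
have gQ : g \notin Q by rewrite inQ // eq_sym.
rewrite cat_uniq uQ /= inE (negbTE b2g) uH (negbTE b2Q) (negbTE gQ) /= (negbTE (inH _ b2W)).
rewrite (negbTE (inH _ gW)) /= andbT; apply/hasPn => z /subH zW.
apply: inQ; last exact: disW.
by apply: contraNneq b1W => <-.
Qed.

Lemma diagonal_extension c m :
  3 <= m -> 3 * m.+1 + (m - 1) %/ 2 <= #|V| -> has_lcycle c true m.-1 ->
  has_lcycle c true m || has_lcycle c false m.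
Proof.
move=> m3 card_V /has_lcycleP[p [size_p up cyc]].
case: (boolP (has_lcycle c true m)) => //= no_cyc.
have [W [un size_W]] := outer_vertices up.
have W_big : 6 + (m - 1) %/ 2 <= size W by rewrite size_W size_p; arith.
have uW : uniq W by move: un; rewrite cat_uniq => /and3P[].
have mE : m.-1.+1 = m by arith.
case: W un size_W W_big uW => [|v1 [|v2 [|v3 T]]] un size_W W_big uW; [by move: W_big => /=; arith..|].
have T_big : (m - 1) %/ 2 + 3 <= size T by move: W_big => /=; arith.
case: p size_p up cyc un size_W => [|b1 [|b2 [|g rest]]] size_p up cyc un size_W;
  [by move: size_p => /=; arith..|].
case/lastP: rest size_p up cyc un size_W => [|rest u] size_p up cyc un size_W.
  by move: size_p => /=; arith.
set W := v1 :: v2 :: v3 :: T in un size_W W_big uW.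
have size_rest : size (rcons rest u) = 3 * (m - 2) by move: size_p => /=; arith.
have tg : tight c 2 u [:: b1; b2] g W.
  apply: (@cycle_tight V c 1 [:: b1; b2] g (rcons rest u) u W m.-1) => //=; rewrite ?mE //.
  - by rewrite size_rest; arith.
  - by have := @last_tail V g (rcons rest u) 3; rewrite last_rcons size_rcons; apply.
have [uT v1T v2T v3T] : [/\ uniq T, v1 \notin T, v2 \notin T & v3 \notin T].
  by move: uW; rewrite /= !inE !negb_or => /and4P[/and3P[_ _ ->] /andP[_ ->] -> ->].
have uv : uniq [:: v1; v2; v3].
  by move: uW; rewrite /= !inE !negb_or => /and4P[/and3P[-> -> _] /andP[-> _] _ _].
have [joins|joins] := double_single tg uv (fun z zW => zW) v1T v2T v3T; last first.
  by apply: (double_closing m3 no_cyc _ cyc un uT _ uW joins T_big).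
have dvd_rest : 3 %| size (rcons (rev rest) g).
  by rewrite size_rcons size_rev -(size_rcons rest u) size_rest dvdn_mulr.
(* If the half at the entry [u] is the good one, the cycle is traversed backwards, which exchanges
   [u, b1] with [g, b2]. *)
apply: (@double_closing c m b2 b1 u (rcons (rev rest) g) W T v1 v2 v3) => //.
- by rewrite /= size_rcons size_rev -(size_rcons rest u) size_rest; arith.
- rewrite (lcycle_rot c true (p := [:: b2; b1; u]) _ dvd_rest) //.
  have -> : rcons (rev rest) g ++ [:: b2; b1; u] = rcons (rev ([:: b1; b2; g] ++ rest)) u.
    by rewrite rev_cat -!cats1 -!catA.
  rewrite lcycle_rev ?rcons_cat //.
  by move: size_p; rewrite /= !size_rcons /= => ->; rewrite dvdn_mulr.
- rewrite -(perm_uniq (s1 := [:: b1, b2, g & rcons rest u] ++ W)) //.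
  apply/permP => a; rewrite !count_cat -!cats1 /= !count_cat /= count_rev.
  by arith.
by move=> x y xT yT xy xA yA; rewrite -(joined_eq c _ _ _ _ (P := [:: u; b1; v1; v2; v3])) ?joins // => z;
   rewrite !inE orbCA.
Qed.

Lemma has_lcycle_neg c b n : has_lcycle (negb \o c) b n = has_lcycle c (~~ b) n.
Proof.
have lneg x p : lpath (negb \o c) b x p = lpath c (~~ b) x p.
  elim: {p}(size p) {-2}p (leqnn (size p)) x => [|k IHk] p; first by case: p.
  case: p => [|v1 [|v2 [|v3 p]]] //= size_p x; rewrite IHk; last by arith.
  by congr (_ && _); case: (c _); case: (b).
apply: eq_existsb => p; congr (_ && _); rewrite /lcycle; case: (tval p) => // x q; exact: lneg.
Qed.

(** Six vertices in three pairs give three edges, each a union of two pairs. Two edges have the same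
    colour and meet in exactly one pair, so they form a cycle with two edges. *)
Lemma two_cycle c : 6 <= #|V| -> exists b, has_lcycle c b 2.
Proof.
rewrite cardE; have := enum_uniq V.
case: (enum V) => [|v1 [|v2 [|v3 [|v4 [|v5 [|v6 vs]]]]]] //=.
rewrite !inE !negb_or -!andbA => un _.
repeat match goal with K : is_true (_ && _) |- _ => case/andP: K => ? ? end.
have cyc b p : size p = 6 -> uniq p -> lcycle c b p -> has_lcycle c b 2.
  by move=> size_p up cp; apply/has_lcycleP; exists p.
have setC w x y z w' x' y' z' : perm_eq [:: w; x; y; z] [:: w'; x'; y'; z'] ->
    c [set v in [:: w; x; y; z]] = c [set v in [:: w'; x'; y'; z']].
  by move=> pm; congr (c _); apply: eq_set_seq => v; rewrite (perm_mem pm).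
set A := c [set v in [:: v1; v2; v3; v4]]; set B := c [set v in [:: v1; v2; v5; v6]].
set C := c [set v in [:: v3; v4; v5; v6]].
have [AB|AB] := eqVneq A B.
  exists A; apply: (cyc _ [:: v3; v4; v1; v5; v6; v2]) => //=; first by distinct.
  rewrite andbT; apply/andP; split; apply/eqP; last rewrite AB; apply: setC; reorder.
have [AC|AC] := eqVneq A C.
  exists A; apply: (cyc _ [:: v1; v2; v3; v5; v6; v4]) => //=; first by distinct.
  rewrite andbT; apply/andP; split; apply/eqP; last rewrite AC; apply: setC; reorder.
have BC : B = C by move: AB AC; case: A; case: B; case: C.
exists B; apply: (cyc _ [:: v1; v2; v5; v3; v4; v6]) => //=; first by distinct.
rewrite andbT; apply/andP; split; apply/eqP; last rewrite BC; apply: setC; reorder.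
Qed.

Lemma diagonal c m :
  2 <= m -> 3 * m.+1 + (m - 1) %/ 2 <= #|V| -> exists b, has_lcycle c b m.
Proof.
elim: m c => // m IHm c; rewrite leq_eqVlt => /orP[/eqP m2|m2] card_V.
  by rewrite -m2; apply: two_cycle; rewrite -m2 in card_V; arith.
have [b cyc] : exists b, has_lcycle c b m by apply: IHm; arith.
case: b cyc => cyc.
  by have /orP[] := diagonal_extension (m := m.+1) m2 card_V cyc; [exists true|exists false].
have cyc' : has_lcycle (negb \o c) true m by rewrite has_lcycle_neg.
have := diagonal_extension (m := m.+1) m2 card_V cyc'; rewrite !has_lcycle_neg.
by case/orP; [exists false|exists true].
Qed.

Lemma cycle_ramsey c n m :
  3 <= m -> m < n -> 3 * n + (m - 1) %/ 2 <= #|V| -> has_lcycle c true n || has_lcycle c false m.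
Proof.
move=> m3; elim: n => // n IHn; rewrite ltnS leq_eqVlt => /orP[/eqP mn|mn] card_V.
  (* For [n = m + 1] a monochromatic cycle with [m] edges is either blue, as wanted, or red and then
     extended. *)
  rewrite -mn in card_V *; have [[] cyc] := @diagonal c m (ltnW m3) card_V.
    by apply: cycle_extension; rewrite ?m3 ?leqnn.
  by rewrite cyc orbT.
have card_V' : 3 * n + (m - 1) %/ 2 <= #|V| by arith.
case/orP: (IHn mn card_V') => [cyc|->]; last by rewrite orbT.
by apply: cycle_extension; rewrite ?m3 // ltnW.
Qed.

End Diagonal.

(** * From lists of vertices to embeddings of the loose cycle *)

Lemma lpath_nth (V : finType) (c : {set V} -> bool) b x p i :
  lpath c b x p -> 3 * i + 3 <= size p ->
  c [set z in [seq nth x (x :: p) (3 * i + k) | k <- iota 0 4]] = b.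
Proof.
elim: i x p => [|i IHi] x [|v1 [|v2 [|v3 p]]] cp size_p; try by move: size_p => /=; lia.
  by move: cp => /= /andP[/eqP cE _]; exact: cE.
have /andP[_ cp'] := cp; rewrite -(IHi _ _ cp'); last by move: size_p => /=; lia.
congr (c _); apply: eq_set_seq => z; congr (z \in _); apply/eq_in_map => k.
rewrite mem_iota => k4; have -> : 3 * i.+1 + k = (3 * i + k).+3 by lia.
by apply: set_nth_default => /=; move: size_p => /=; lia.
Qed.

Lemma mono_cycle_of_lcycle N (c : coloring N) b n :
  0 < n -> has_lcycle c b n -> has_mono_cycle c b n.
Proof.
move=> n_gt0 /has_lcycleP[]; case/lastP=> [|p x]; first by rewrite /= => -[]; lia.
rewrite size_rcons => -[size_p up cyc].
have size_xp : size (x :: p) = 3 * n by [].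
have uxp : uniq (x :: p) by move: up; rewrite rcons_uniq.
rewrite (lcycleE _ _ x) last_rcons in cyc.
(* The last vertex of the list is placed at position 0, because the cycle is read as a path starting
   there. *)
exists (fun i => nth x (x :: p) i); split.
  move=> i j /eqP; rewrite nth_uniq ?size_xp // => /eqP; exact: val_inj.
move=> i i_n; have := lpath_nth cyc (i := i); rewrite size_rcons size_p => <-; last by lia.
have nth_mod k : k < 4 ->
    nth x (x :: rcons p x) (3 * i + k) = nth x (x :: p) ((3 * i + k) %% (3 * n)).
  move=> k4; rewrite -rcons_cons nth_rcons size_xp.
  have [lt_n|ge_n] := ltnP (3 * i + k) (3 * n); first by rewrite modn_small.
  (* Only the last vertex of the last edge reaches [3 * n], and it wraps around to position 0. *)
  have -> : 3 * i + k = 3 * n by lia.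
  by rewrite eqxx modnn.
congr (c _); apply/setP=> z; rewrite inE; apply/imsetP/mapP.
  move=> [j]; rewrite inE => /existsP[k /eqP jE] ->; exists (val k).
    by rewrite mem_iota /= ltn_ord.
  by rewrite nth_mod ?ltn_ord // -jE.
move=> [k]; rewrite mem_iota /= add0n => k4 ->.
have lt_n : (3 * i + k) %% (3 * n) < 3 * n by rewrite ltn_mod; lia.
exists (Ordinal lt_n); last by rewrite nth_mod.
by rewrite inE; apply/existsP; exists (Ordinal k4).
Qed.

(** * The lower bound *)

Lemma loose_edge_mem n i (x : 'I_(3 * n)) :
  i < n -> x \in loose_edge n i -> (i == x %/ 3) || (i == (x + 3 * n - 3) %/ 3 %% n).
Proof.
move=> i_n; rewrite inE => /existsP[k /eqP xE]; have k4 := ltn_ord k.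
have {xE} -> : nat_of_ord x = (3 * i + k) %% (3 * n) := xE; move: (nat_of_ord k) k4 => {}k k4.
have [lt_n|ge_n] := ltnP (3 * i + k) (3 * n).
  rewrite modn_small //; have [k3|k3] := ltnP k 3; apply/orP; [left; lia | right].
  by have -> : (3 * i + k + 3 * n - 3) %/ 3 = i + n; [lia | rewrite modnDr modn_small].
have -> : 3 * i + k = 3 * n by lia.
rewrite modnn; apply/orP; right.
by have -> : (0 + 3 * n - 3) %/ 3 = i; [lia | rewrite modn_small].
Qed.

(** A red cycle would put [3n] vertices into a set of [3n - 1]. In a blue cycle every edge meets the
    set [B] of positions mapped outside that set, so [m <= 2 * #|B|], which is less than [m]. *)
Lemma not_ramsey n m N : 0 < n -> 0 < m -> N < 3 * n + (m - 1) %/ 2 -> ~ ramsey_prop n m N.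
Proof.
move=> n_gt0 m_gt0 N_small /(_ (fun e => e \subset [set x : 'I_N | x < 3 * n - 1])) [].
  case=> f [f_inj red]; have sub x : f x \in [set y : 'I_N | y < 3 * n - 1].
    have i_n : x %/ 3 < n by have := ltn_ord x; lia.
    apply: (subsetP (red _ i_n)); apply: imset_f; rewrite inE.
    have k4 : x %% 3 < 4 by have := ltn_pmod x (isT : 0 < 3); lia.
    apply/existsP; exists (Ordinal k4) => /=.
    by have xE : 3 * (x %/ 3) + x %% 3 = x; [lia | rewrite xE modn_small].
  have bound x : f x < 3 * n - 1 by have := sub x; rewrite inE.
  have g_inj : injective (fun x => Ordinal (bound x)).
    by move=> x y /(congr1 val) /= /val_inj/f_inj.
  by have := leq_card _ g_inj; rewrite !card_ord; lia.
case=> f [f_inj blue].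
pose B := [set x : 'I_(3 * m) | 3 * n - 1 <= f x].
have B_small : #|B| <= (m - 1) %/ 2.
  pose h (x : 'I_(3 * m)) := nat_of_ord (f x) - (3 * n - 1).
  have h_lt x : x \in B -> h x < (m - 1) %/ 2.
    by rewrite inE /h; have := ltn_ord (f x); lia.
  have h_inj : {in B &, injective h}.
    move=> x y; rewrite !inE /h => hx hy hxy; apply: f_inj; apply: val_inj => /=; lia.
  rewrite cardE -(size_map h) -[X in _ <= X](size_iota 0); apply: uniq_leq_size.
    rewrite map_inj_in_uniq ?enum_uniq // => x y.
    by rewrite !mem_enum; apply: h_inj.
  by move=> _ /mapP[x x_B ->]; rewrite mem_iota /= h_lt // -mem_enum.
have pick (i : 'I_m) : exists y, (y \in B) && (y \in loose_edge m i).
  have /negbT/subsetPn[_ /imsetP[y y_i ->]] := blue i (ltn_ord i).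
  by rewrite inE -leqNgt => yB; exists y; rewrite inE yB.
pose y i := xchoose (pick i).
have yP i : (y i \in B) && (y i \in loose_edge m i) := xchooseP (pick i).
(* A vertex lies on at most two edges, so the chosen vertex of [B] and one bit determine the
   edge. *)
have code_inj : injective (fun i : 'I_m => (y i, nat_of_ord i == y i %/ 3)).
  move=> i j [yij bij]; have /andP[_ yi] := yP i; have /andP[_ yj] := yP j.
  have li := loose_edge_mem (ltn_ord i) yi; have lj := loose_edge_mem (ltn_ord j) yj.
  rewrite yij in li bij; rewrite bij in li; apply: val_inj.
  have [E|E] := boolP (nat_of_ord j == y j %/ 3).
    by move: bij; rewrite E => /eqP /= ->; rewrite (eqP E).
  by rewrite (negbTE E) /= in li lj; rewrite /= (eqP li) (eqP lj).
have sub : [set (y i, nat_of_ord i == y i %/ 3) | i in 'I_m] \subset setX B [set: bool].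
  by apply/subsetP=> _ /imsetP[i _ ->]; rewrite !inE /=; have /andP[+ _] := yP i; rewrite inE => ->.
have := subset_leq_card sub; rewrite card_imset // cardsX cardsT card_bool card_ord.
by move: B_small; lia.
Qed.

Theorem theorem3p2 (n m : nat) (hm : 4 <= m + 1) (hnm : m + 1 <= n) :
  ramsey_cycle_is n m (3 * n + (m - 1) %/ 2).
Proof.
split=> [c|N' N'_small]; last by apply: not_ramsey N'_small; lia.
have /orP[red|blue] : has_lcycle c true n || has_lcycle c false m.
  by apply: cycle_ramsey; rewrite ?card_ord; lia.
- by left; apply: mono_cycle_of_lcycle red; lia.
- by right; apply: mono_cycle_of_lcycle blue; lia.
Qed.
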